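(* Let $\Gamma=\Gamma_1\cup\Gamma_2\subset\mathbb{R}^2$, where $\Gamma_1=\{e^{i\theta}: 0\le\theta\le 2\pi\}$ is the unit circle and $\Gamma_2=\{(r,0): r>1\}\cong[1,\infty)$. Let $a\in L_2(0,2\pi)$ and $\alpha:=\frac{1}{2\pi}\int_0^{2\pi}a(\theta)\,d\theta$. If $\alpha\notin\mathbb{Z}$, then $$h_a[u] \geq \lambda_*(\alpha) \int_\Gamma \psi\, |u|^2 \,dx \quad\text{for all } u\in H^1(\Gamma),$$ where $\psi(\theta):=1$ on $\Gamma_1$ and $\psi(r):=r^{-2}$ on $\Gamma_2$. The constant $\lambda_*(\alpha)$ is sharp.
   Context: A function $u$ on $\Gamma$ is identified with the pair $(u_1,u_2)$, where $u_1(\theta)=u(e^{i\theta})$, $\theta\in[0,2\pi]$, and $u_2(r)=u((r,0))$, $r\ge1$. $H^1(\Gamma)$ consists of continuous functions on $\Gamma$ (so $u_1(0)=u_1(2\pi)=u_2(1)$) with $u_1\in H^1(0,2\pi)$, $u_2\in H^1(1,\infty)$. The quadratic form is $$h_a[u]=\int_0^{2\pi}|-iu_1'(\theta)-a(\theta)u_1(\theta)|^2\,d\theta+\int_1^\infty|u_2'(r)|^2\,dr,$$ and $\int_\Gamma \psi|u|^2dx=\int_0^{2\pi}|u_1|^2d\theta+\int_1^\infty r^{-2}|u_2(r)|^2dr$. For $0<\alpha\le 1/2$, $\lambda_*(\alpha)$ is the unique solution $\lambda\in(0,\alpha^2)$ of $\cos(2\pi\alpha)=\cos(2\pi\sqrt\lambda)-\frac{1-\sqrt{1-4\lambda}}{4\sqrt\lambda}\sin(2\pi\sqrt\lambda)$;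 $\lambda_*$ is then extended to an even, $1$-periodic function on $\mathbb{R}$. *)

(* Defs.v *)
From HB Require Import structures.
From mathcomp Require Import all_boot all_order all_algebra.
From mathcomp Require Import all_classical all_reals all_analysis.
Set Implicit Arguments. Unset Strict Implicit. Unset Printing Implicit Defensive.
Import Order.TTheory GRing.Theory Num.Theory.
Import numFieldNormedType.Exports.
Local Open Scope classical_set_scope.
Local Open Scope ring_scope.

Section Defs.
Context {R : realType}.
Local Notation mu := (@lebesgue_measure R).
Definition twopi : R := 2 * pi.
Definition I1 : set R := `]0, twopi[.
Definition I2 : set R := `]1, +oo[.

Definition L2on (D : set R) (f : R -> R) : Prop :=
  measurable_fun D f /\ (\int[mu]_(x in D) ((f x) ^+ 2)%:E < +oo)%E.

Definition smooth (phi : R -> R) : Prop :=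
  forall (n : nat) (x : R), derivable (iter n (@derive1 R R) phi) x 1.

Definition test_fun (D : set R) (phi : R -> R) : Prop :=
  smooth phi /\
  exists K : set R, [/\ compact K, K `<=` D & forall x, ~ K x -> phi x = 0].

Definition weak_deriv (D : set R) (f g : R -> R) : Prop :=
  forall phi, test_fun D phi ->
    (\int[mu]_(x in D) (f x * derive1 phi x)%:E
     = - \int[mu]_(x in D) (g x * phi x)%:E)%E.

Definition H1 (D : set R) (f g : R -> R) : Prop :=
  [/\ L2on D f, L2on D g & weak_deriv D f g].

(** u = (u1, u2) in H^1(Gamma), complex valued: u1 = p1 + i q1 on the circle
   (parametrised by theta in [0, 2 pi]), u2 = p2 + i q2 on the ray r >= 1;
   dp1 dq1 dp2 dq2 are the weak derivatives.  Continuous representatives,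
   glued continuously at the junction point. *)
Definition H1_Gamma (p1 q1 dp1 dq1 p2 q2 dp2 dq2 : R -> R) : Prop :=
  [/\ [/\ H1 `]0, twopi[ p1 dp1, H1 `]0, twopi[ q1 dq1,
          H1 `]1, +oo[ p2 dp2 & H1 `]1, +oo[ q2 dq2],
      [/\ {within `[0, twopi], continuous p1},
          {within `[0, twopi], continuous q1},
          {within `[1, +oo[, continuous p2} &
          {within `[1, +oo[, continuous q2}] &
      [/\ p1 0 = p1 (twopi), p1 0 = p2 1, q1 0 = q1 (twopi) & q1 0 = q2 1]].

(** h_a[u] = int_0^{2pi} |-i u1' - a u1|^2 + int_1^oo |u2'|^2, where
   -i u1' - a u1 = (dq1 - a p1) + i (-(dp1 + a q1)). *)
Definition h_form (a p1 q1 dp1 dq1 dp2 dq2 : R -> R) : \bar R :=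
  (\int[mu]_(x in I1)
      (((dq1 x - a x * p1 x) ^+ 2 + (dp1 x + a x * q1 x) ^+ 2)%:E)
   + \int[mu]_(x in I2) (((dp2 x) ^+ 2 + (dq2 x) ^+ 2)%:E))%E.

Definition weighted_L2 (p1 q1 p2 q2 : R -> R) : \bar R :=
  (\int[mu]_(x in I1) (((p1 x) ^+ 2 + (q1 x) ^+ 2)%:E)
   + \int[mu]_(x in I2) ((x ^- 2 * ((p2 x) ^+ 2 + (q2 x) ^+ 2))%:E))%E.

Definition alpha_of (a : R -> R) : R :=
  (twopi)^-1 * fine (\int[mu]_(x in I1) (a x)%:E).

Definition lam_star_eq (b l : R) : Prop :=
  [/\ 0 < l, l < b ^+ 2 &
      cos (twopi * b) = cos (twopi * Num.sqrt l)
        - (1 - Num.sqrt (1 - 4 * l)) / (4 * Num.sqrt l) * sin (twopi * Num.sqrt l)].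

Definition dist_int (al : R) : R :=
  let f := al - (Num.floor al)%:~R in Num.min f (1 - f).

(** lambda_* extended as an even 1-periodic function: the (unique) solution
   for the parameter dist_int alpha. *)
Definition lam_star (al : R) : R := xget 0 [set l | lam_star_eq (dist_int al) l].

End Defs.

(* Main.v *)
Require Import Defs.
From HB Require Import structures.
From mathcomp Require Import all_boot all_order all_algebra.
From mathcomp Require Import all_classical all_reals all_analysis.
From mathcomp Require Import measurable_realfun ring lra.
Import Order.TTheory GRing.Theory Num.Theory.
Import numFieldNormedType.Exports.
Local Open Scope classical_set_scope.
Local Open Scope ring_scope.
Set Implicit Arguments.
Unset Strict Implicit.
Unset Printing Implicit Defensive.

(** On the ray, [u = r^s] with [s - s^2 = lambda], [s < 1/2], solves the Euler
    equation, and completing the square gives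
    [int u'^2 - lambda u^2 / r^2 >= - s |u 1|^2].  On the circle, the gauge
    transformation [u = exp (i A) w] with [A' = a] removes the potential and
    leaves the twisted condition [w (2 pi) = exp (- 2 pi i alpha) w 0]; since
    [k = sqrt lambda < 1/2], the minimum of [int |w'|^2 - k^2 |w|^2] for given
    boundary values is attained by the solution of [w'' = - k^2 w] and equals
    [2 k (cos (2 pi k) - cos (2 pi alpha)) / sin (2 pi k) |u 1|^2].  The equation
    defining [lambda_*] says that this coefficient is [s], so that the two
    contributions at the junction cancel.  Truncations of the extremal pair show
    sharpness.  Since [a] is only square integrable, all integrations by parts
    are carried out for absolutely continuous functions. *)

(** Put k = sqrt lambda and s = (1 - sqrt (1 - 4 lambda)) / 2. The fraction in the equation for
    lambda is then s / (2 k), and solving for s turns that equation into the circle coefficient. The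
    bound lambda < 1/4 serves three times: it makes s real; it gives 2 pi k < pi, so the sine is
    positive and the circle energy is bounded below once its boundary values are fixed; and it gives
    2 s < 1, so that cutting t^s off over a length M costs only about M^(2 s - 1). Since t^s is not
    square integrable on the ray, the extremal pair lies outside H^1, and sharpness has to come from
    approximate extremals whose weighted norm stays bounded away from 0.

    The definition of H^1 offers only weak derivatives tested against smooth functions. Passing to
    primitives takes a smooth step function, built here from exp (-1/x). For primitives of merely
    integrable functions, the only outer functions met are the square, the sine and the cosine.
    Their derivatives are globally Lipschitz, so a partition argument yields the chain rule without
    differentiation almost everywhere. *)

Section interval_integrals.
Context {R : realType}.
Local Notation mu := (@lebesgue_measure R).
Implicit Types (f g h : R -> R) (a b c x y z : R) (C K M e : R).

Local Notation itg a b f := (mu.-integrable `[a, b] (EFin \o f)).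

(** * Integrals over segments and absolutely continuous functions *)

Lemma integrable_sub_itv a b x y f :
  itg a b f -> a <= x -> y <= b -> itg x y f.
Proof.
by move=> fi ax yb; apply: integrableS fi => //; apply: subset_itvScc.
Qed.

Lemma Rintegral_itv_chasles f a x b : itg a b f -> a <= x -> x <= b ->
  \int[mu]_(t in `[a, b]) f t
  = \int[mu]_(t in `[a, x]) f t + \int[mu]_(t in `[x, b]) f t.
Proof.
move=> fi ax xb; apply/eqP; rewrite addrC -subr_eq; apply/eqP.
rewrite -(@Rintegral_itv_obnd_cbnd _ x); last first.
  by apply: integrableS fi => //; apply: subset_itvScc; rewrite bnd_simp.
by rewrite -(@Rintegral_itvB _ f (BLeft a) (BRight b) x).
Qed.

Lemma integrable_itvD a b f g : itg a b f -> itg a b g ->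
  itg a b (fun t => f t + g t).
Proof. by move=> fi gi; exact: (integrableD _ fi gi). Qed.

Lemma integrable_itvZ a b c f : itg a b f -> itg a b (fun t => c * f t).
Proof. by move=> fi; exact: (integrableZl _ c fi). Qed.

Lemma integrable_itvB a b f g : itg a b f -> itg a b g ->
  itg a b (fun t => f t - g t).
Proof. by move=> fi gi; exact: (integrableB _ fi gi). Qed.

Lemma eq_integrable_itv a b f g : (forall t, a <= t <= b -> f t = g t) ->
  itg a b f -> itg a b g.
Proof.
move=> fg; apply: eq_integrable => // t; rewrite inE/= in_itv/= => tab.
by rewrite /= fg.
Qed.

Lemma eq_Rintegral_itv a b f g : (forall t, a <= t <= b -> f t = g t) ->
  \int[mu]_(t in `[a, b]) f t = \int[mu]_(t in `[a, b]) g t.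
Proof.
by move=> fg; apply: eq_Rintegral => t; rewrite inE/= in_itv/= => /fg.
Qed.

Lemma integrable_itv_bddM a b M h g : measurable_fun `[a, b] h ->
  (forall t, a <= t <= b -> `|h t| <= M) ->
  itg a b g -> itg a b (fun t => h t * g t).
Proof.
move=> mh hM gi; have mI : measurable (`[a, b]%classic : set (measurableTypeR R)) by [].
suff bh : [bounded h x | x in `[a, b]%classic] by exact: (integrableMr mI mh bh gi).
exists M; split; first exact: num_real.
move=> N MN t /=; rewrite in_itv/= => tab.
by rewrite (le_trans (hM _ tab))// ltW.
Qed.

Lemma within_continuous_mul (D : set R) f g :
  {within D, continuous f} -> {within D, continuous g} ->
  {within D, continuous (fun t => f t * g t)}.
Proof.
by move=> cf cg t; apply: (@continuousM _ (subspace D)); [exact: cf|exact: cg].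
Qed.

Lemma within_continuous_add (D : set R) f g :
  {within D, continuous f} -> {within D, continuous g} ->
  {within D, continuous (fun t => f t + g t)}.
Proof.
by move=> cf cg t; apply: (@continuousD _ _ (subspace D)); [exact: cf|exact: cg].
Qed.

Lemma within_continuous_cst (D : set R) (c : R) :
  {within D, continuous (fun=> c)}.
Proof. exact: continuous_subspaceT (@cst_continuous _ _ _). Qed.

Lemma continuous_itv_measurable a b f :
  {within `[a, b], continuous f} -> measurable_fun `[a, b] f.
Proof. by move=> cf; apply: subspace_continuous_measurable_fun. Qed.

Lemma continuous_itv_integrable a b f :
  {within `[a, b], continuous f} -> itg a b f.
Proof.
by move=> cf; apply: continuous_compact_integrable => //; exact: segment_compact.
Qed.

Lemma continuous_itv_bounded a b f :
  {within `[a, b], continuous f} ->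
  exists M, forall t, a <= t <= b -> `|f t| <= M.
Proof.
move=> cf.
have /compact_bounded[M [_ HM]] :=
  continuous_compact cf (@segment_compact _ a b).
exists (M + 1) => t tab; apply: (HM (M + 1)); first by rewrite ltrDl.
by exists t => //=; rewrite in_itv.
Qed.

Lemma integrable_itv_continuousM a b h g :
  {within `[a, b], continuous h} ->
  itg a b g -> itg a b (fun t => h t * g t).
Proof.
move=> ch; have [M hM] := continuous_itv_bounded ch.
exact: (integrable_itv_bddM (continuous_itv_measurable ch) hM).
Qed.

Lemma Rintegral_itv_abs_le a b f g : itg a b f -> itg a b g ->
  (forall t, a <= t <= b -> `|f t| <= g t) ->
  `|\int[mu]_(t in `[a, b]) f t| <= \int[mu]_(t in `[a, b]) g t.
Proof.
move=> fi gi fg; apply: (le_trans (le_normr_Rintegral _ fi)) => //.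
apply: le_Rintegral => //; first exact: (integrable_norm fi).
Qed.

(** Absolute continuity of the integral on the whole line, applied to the extension of [g] by zero;
    [d] is uniform in the position of the subinterval. *)
Lemma Rintegral_norm_small a b g e : itg a b g -> 0 < e ->
  exists2 d, 0 < d & forall x y, a <= x -> x <= y -> y <= b -> y - x < d ->
    \int[mu]_(t in `[x, y]) `|g t| < e.
Proof.
move=> gi e0.
have gr : mu.-integrable setT (EFin \o (g \_ `[a, b])).
  by rewrite -restrict_EFin; apply/integrable_restrict => //=; rewrite setTI.
have [d [d0 Hd]] := integral_normr_continuous gr e0.
have {}Hd : forall A, measurable A -> (mu A < d%:E)%E ->
    \int[mu]_(x in A) `|(g \_ `[a, b]) x| < e by exact: Hd.
exists d => // x y ax xy yb yxd.
have -> : \int[mu]_(t in `[x, y]) `|g t|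
        = \int[mu]_(t in `[x, y]) `|(g \_ `[a, b]) t|.
  apply: eq_Rintegral_itv => t /andP[xt ty].
  by rewrite patchE mem_set//= in_itv/= (le_trans ax xt) (le_trans ty yb).
apply: Hd => //; rewrite lebesgue_measure_itv/= lte_fin.
by case: ifP => _; rewrite -?EFinD lte_fin.
Qed.

(* [f] is a primitive of the integrable function [g] on [[a, b]], that is, [f]
   is absolutely continuous with derivative [g] almost everywhere. *)
Definition primitive_on a b f g : Prop := itg a b g /\
  forall x y, a <= x -> x <= y -> y <= b ->
    f y - f x = \int[mu]_(t in `[x, y]) g t.

Lemma primitive_on_integral a b g : itg a b g ->
  primitive_on a b (fun x => \int[mu]_(t in `[a, x]) g t) g.
Proof.
move=> gi; split=> // x y ax xy yb.
rewrite (@Rintegral_itv_chasles g a x y)//; first by ring.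
exact: integrable_sub_itv gi _ _.
Qed.

Lemma eq_primitive_on a b f f' g g' :
  (forall t, a <= t <= b -> f t = f' t) ->
  (forall t, a <= t <= b -> g t = g' t) ->
  primitive_on a b f g -> primitive_on a b f' g'.
Proof.
move=> ff gg [gi fg]; split; first exact: eq_integrable_itv gi.
move=> x y ax xy yb.
rewrite -!ff ?ax ?yb ?(le_trans ax xy)// ?(le_trans xy yb)//.
rewrite fg//; apply: eq_Rintegral_itv => t /andP[xt ty].
by rewrite gg// (le_trans ax xt) (le_trans ty yb).
Qed.

Lemma primitive_on_continuous a b f g : a <= b ->
  primitive_on a b f g -> {within `[a, b], continuous f}.
Proof.
move=> ab [gi fg].
apply: (@subspace_eq_continuous _ _ _
  (fun x => f a + parameterized_integral mu a x g)).
  move=> x; rewrite inE/= in_itv/= => /andP[ax xb].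
  by rewrite /parameterized_integral -fg//; rewrite addrC subrK.
move=> x; apply: (@continuousD _ _ (subspace `[a, b])); first exact: cst_continuous.
exact: parameterized_integral_continuous.
Qed.

Lemma primitive_onD a b f g f' g' :
  primitive_on a b f f' -> primitive_on a b g g' ->
  primitive_on a b (fun t => f t + g t) (fun t => f' t + g' t).
Proof.
move=> [fi ff] [gi gg]; split; first exact: integrable_itvD.
move=> x y ax xy yb; rewrite RintegralD//; first by rewrite -ff// -gg//; ring.
- exact: integrable_sub_itv fi _ _.
- exact: integrable_sub_itv gi _ _.
Qed.

Lemma primitive_onZ a b c f f' : primitive_on a b f f' ->
  primitive_on a b (fun t => c * f t) (fun t => c * f' t).
Proof.
move=> [fi ff]; split; first exact: integrable_itvZ.
move=> x y ax xy yb; rewrite RintegralZl//; first by rewrite -ff//; ring.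
exact: integrable_sub_itv fi _ _.
Qed.

Lemma primitive_onB a b f g f' g' :
  primitive_on a b f f' -> primitive_on a b g g' ->
  primitive_on a b (fun t => f t - g t) (fun t => f' t - g' t).
Proof.
move=> ff gg; have := primitive_onD ff (primitive_onZ (-1) gg).
by apply: eq_primitive_on => t _; rewrite mulN1r.
Qed.

(** Cutting [[a, b]] into equal pieces on each of which [N] is below e' bounds the sum of the
    squares of [N] by e' times the total [N a b], and e' is arbitrary. *)
Lemma additive_quadratic_eq0 a b C (D N : R -> R -> R) : a <= b -> 0 <= C ->
  (forall x y z, a <= x -> x <= y -> y <= z -> z <= b -> D x z = D x y + D y z) ->
  (forall x y z, a <= x -> x <= y -> y <= z -> z <= b -> N x z = N x y + N y z) ->
  (forall x y, a <= x -> x <= y -> y <= b -> `|D x y| <= C * N x y ^+ 2) ->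
  (forall x y, a <= x -> x <= y -> y <= b -> 0 <= N x y) ->
  (forall e, 0 < e -> exists2 d, 0 < d &
     forall x y, a <= x -> x <= y -> y <= b -> y - x < d -> N x y < e) ->
  D a b = 0.
Proof.
move=> ab C0 DD ND DN N0 Ns; apply/eqP; rewrite -normr_le0; apply/ler_addgt0Pl.
move=> e e0; rewrite addr0.
(* The added 1 keeps the denominator positive when [C * N a b] vanishes. *)
pose e' := e / (C * N a b + 1).
have K0 : 0 < C * N a b + 1 by rewrite ltr_wpDl// mulr_ge0// N0.
have e'0 : 0 < e' by rewrite divr_gt0.
have [d d0 Hd] := Ns _ e'0.
pose n := (Num.truncn ((b - a) / d)).+1.
have nd : (b - a) / n%:R < d.
  rewrite ltr_pdivrMr ?ltr0n// mulrC -ltr_pdivrMr//.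
  exact: truncnS_gt.
pose x i := a + i%:R * ((b - a) / n%:R).
have h0 : 0 <= (b - a) / n%:R by rewrite divr_ge0 ?subr_ge0// ler0n.
have ax i : a <= x i by rewrite lerDl mulr_ge0.
have xS i : x i.+1 = x i + (b - a) / n%:R by rewrite /x -natr1; ring.
have xb i : (i <= n)%N -> x i <= b.
  move=> ilen; rewrite -lerBrDl mulrCA ler_piMr ?subr_ge0//.
  by rewrite ler_pdivrMr ?ltr0n// mul1r ler_nat.
have xn : x n = b.
  by rewrite /x mulrCA divff ?mulr1 ?pnatr_eq0//; ring.
have x0 : x 0%N = a by rewrite /x mul0r addr0.
have ind i : (i <= n)%N -> `|D a (x i)| <= C * e' * N a (x i).
  elim: i => [_|i IH Sin].
    rewrite x0.
    (* Additivity on the degenerate interval reads D = D + D, which forces the value 0. *)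
    have := DD a a a (lexx _) (lexx _) (lexx _) ab.
    have := ND a a a (lexx _) (lexx _) (lexx _) ab.
    move=> Naa Daa.
    have -> : D a a = 0 by lra.
    have -> : N a a = 0 by lra.
    by rewrite normr0 mulr0.
  have xx : x i <= x i.+1 by rewrite xS lerDl.
  rewrite (DD a (x i) (x i.+1))// ?xb// (ND a (x i) (x i.+1))// ?xb//.
  rewrite (le_trans (ler_normD _ _))// mulrDr lerD ?IH 1?ltnW//.
  rewrite (le_trans (DN _ _ _ _ _))// ?xb// expr2 -mulrA ler_wpM2l//.
  rewrite ler_wpM2r// ?N0// ?xb//.
  by apply/ltW/Hd; rewrite // ?xb// xS addrC addKr.
have := ind n (leqnn _); rewrite xn => /le_trans; apply.
rewrite -mulrA mulrCA /e' mulrAC -[leRHS]mulr1 -mulrA ler_wpM2l ?ltW//.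
by rewrite ltr_pdivrMr// mul1r ltrDl.
Qed.

(* The defect [F (f y) - F (f x) - int_x^y F'(f) g] is additive in the interval
   and at most [2 K (int_x^y |g|)^2], so it vanishes on refining partitions. *)
Lemma primitive_on_comp a b K f g (F F' : R -> R) : a <= b -> 0 <= K ->
  (forall u v, `|F v - F u - F' u * (v - u)| <= K * (v - u) ^+ 2) ->
  (forall u v, `|F' v - F' u| <= K * `|v - u|) ->
  primitive_on a b f g ->
  primitive_on a b (fun t => F (f t)) (fun t => F' (f t) * g t).
Proof.
move=> ab K0 HF HF' fg; have [gi fgE] := fg.
have cf := primitive_on_continuous ab fg.
have cF' : continuous F'.
  move=> u; apply/cvgrPdist_le => e e0.
  near=> v; rewrite distrC (le_trans (HF' _ _))//.
  rewrite (le_trans (ler_wpM2r _ (_ : K <= K + 1)))// ?lerDl// mulrC.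
  rewrite -ler_pdivlMr ?ltr_wpDl// distrC ltW//.
  by near: v; apply: cvgr_dist_lt => //; rewrite divr_gt0// ltr_wpDl.
have cF'f : {within `[a, b], continuous (fun t => F' (f t))}.
  by move=> t; apply: (@continuous_comp (subspace `[a, b]) _ _ f F'); [exact: cf|exact: cF'].
have Fgi : itg a b (fun t => F' (f t) * g t) by exact: integrable_itv_continuousM.
split=> // x0 y0 ax0 xy0 yb0.
have absub x y : a <= x -> x <= y -> y <= b -> forall t, x <= t <= y -> a <= t <= b.
  by move=> ax xy yb t /andP[xt ty]; rewrite (le_trans ax xt) (le_trans ty yb).
have ng : itg a b (fun t => `|g t|) by exact: integrable_norm.
pose N x y := \int[mu]_(t in `[x, y]) `|g t|.
have dfN x y : a <= x -> x <= y -> y <= b -> `|f y - f x| <= N x y.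
  move=> ax xy yb; rewrite fgE//; apply: Rintegral_itv_abs_le => //.
  - exact: integrable_sub_itv gi _ _.
  - exact: integrable_sub_itv ng _ _.
have N0 x y : 0 <= N x y by apply: Rintegral_ge0.
have ND x y z : a <= x -> x <= y -> y <= z -> z <= b -> N x z = N x y + N y z.
  move=> ax xy yz zb; apply: Rintegral_itv_chasles => //.
  exact: integrable_sub_itv ng _ _.
pose D x y := F (f y) - F (f x) - \int[mu]_(t in `[x, y]) (F' (f t) * g t).
suff : D x0 y0 = 0 by move/eqP; rewrite subr_eq0 => /eqP.
apply: (@additive_quadratic_eq0 x0 y0 (K + K) D N) => //.
- by rewrite addr_ge0.
- move=> x y z ax xy yz zb; rewrite /D (@Rintegral_itv_chasles _ x y z)//.
    by ring.
  by apply: integrable_sub_itv Fgi _ _; [exact: le_trans ax|exact: le_trans yb0].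
- move=> x y z ax xy yz zb; apply: ND => //.
    exact: le_trans ax.
  exact: le_trans yb0.
- move=> x y /(le_trans ax0) ax xy /le_trans/(_ yb0) yb.
  have gxy : itg x y g by exact: integrable_sub_itv gi _ _.
  have Fgxy := integrable_sub_itv Fgi ax yb.
  have ngxy := integrable_sub_itv ng ax yb.
  (* The defect is the Taylor remainder of [F] at [f x] minus the integrated variation of [F'] along
     the interval; each is at most [K * N x y ^+ 2], whence the constant [K + K]. *)
  have -> : D x y = (F (f y) - F (f x) - F' (f x) * (f y - f x))
      - \int[mu]_(t in `[x, y]) ((F' (f t) - F' (f x)) * g t).
    have -> : \int[mu]_(t in `[x, y]) ((F' (f t) - F' (f x)) * g t)
      = \int[mu]_(t in `[x, y]) (F' (f t) * g t - F' (f x) * g t).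
      by apply: eq_Rintegral_itv => t _; rewrite mulrBl.
    rewrite RintegralB//; last exact: (integrable_itvZ (F' (f x)) gxy).
    by rewrite RintegralZl// -fgE// /D; ring.
  rewrite (le_trans (ler_normB _ _))// mulrDl lerD//.
    rewrite (le_trans (HF _ _))// ler_wpM2l// -real_normK ?num_real//.
    by rewrite ler_pXn2r// ?nnegrE// dfN.
  have -> : K * N x y ^+ 2 = \int[mu]_(t in `[x, y]) (K * N x y * `|g t|).
    by rewrite RintegralZl// -/(N x y); ring.
  apply: Rintegral_itv_abs_le.
  - apply: (@eq_integrable_itv _ _ (fun t => F' (f t) * g t - F' (f x) * g t)).
      by move=> t _; rewrite mulrBl.
    by apply: integrable_itvB => //; exact: integrable_itvZ.
  - exact: integrable_itvZ.
  - move=> t /andP[xt ty]; rewrite normrM ler_wpM2r//.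
    rewrite (le_trans (HF' _ _))// ler_wpM2l//.
    have tb := le_trans ty yb.
    by rewrite (le_trans (dfN _ _ ax xt tb))// (ND x t y)// lerDl.
- by move=> e e0; apply: (@Rintegral_norm_small x0 y0) => //; exact: integrable_sub_itv gi _ _.
Unshelve. all: by end_near. Qed.

Lemma primitive_on_sqr a b f g : a <= b -> primitive_on a b f g ->
  primitive_on a b (fun t => f t ^+ 2) (fun t => 2 * f t * g t).
Proof.
move=> ab; apply: (@primitive_on_comp a b 2 f g (fun u => u ^+ 2) (fun u => 2 * u)) => //.
- move=> u v; have -> : v ^+ 2 - u ^+ 2 - 2 * u * (v - u) = (v - u) ^+ 2 by ring.
  by rewrite ger0_norm ?sqr_ge0// ler_peMl ?sqr_ge0// ler1n.
- by move=> u v; rewrite -mulrBr normrM ger0_norm.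
Qed.

(** Polarization, f g = ((f + g)^2 - f^2 - g^2) / 2, reduces the product rule to the chain rule for
    the square. *)
Lemma primitive_onM a b f g f' g' : a <= b ->
  primitive_on a b f f' -> primitive_on a b g g' ->
  primitive_on a b (fun t => f t * g t) (fun t => f' t * g t + f t * g' t).
Proof.
move=> ab ff gg.
have := primitive_onB (primitive_onB (primitive_on_sqr ab (primitive_onD ff gg))
  (primitive_on_sqr ab ff)) (primitive_on_sqr ab gg).
move=> /(primitive_onZ (2^-1)).
by apply: eq_primitive_on => t _ /=; field.
Qed.

Lemma primitive_on_C1 a b (f f' : R -> R) : a <= b ->
  (forall t, a <= t <= b -> is_derive t 1 f (f' t)) ->
  {within `[a, b], continuous f'} -> primitive_on a b f f'.
Proof.
move=> ab df cf'; split; first exact: continuous_itv_integrable.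
move=> x y ax; rewrite le_eqVlt => /predU1P[<- _|xy yb].
  by rewrite set_itv1 Rintegral_set1 subrr.
have df' t : x <= t <= y -> is_derive t 1 f (f' t).
  by move=> /andP[xt ty]; apply: df; rewrite (le_trans ax xt) (le_trans ty yb).
have cf : {within `[x, y], continuous f}.
  apply: derivable_within_continuous => t; rewrite in_itv/= => txy.
  by have [] := df' _ txy.
rewrite /Rintegral (@continuous_FTC2 _ _ f)//.
- by apply: continuous_subspaceW cf'; apply: subset_itvScc => //.
- have [_ cx cy] := (continuous_within_itvP f xy).1 cf; split => //.
  move=> t; rewrite in_itv/= => /andP[xt ty].
  by have [] : is_derive t 1 f (f' t) by apply: df'; rewrite !ltW.
- move=> t; rewrite in_itv/= => /andP[xt ty]; rewrite derive1E.
  by have [_ ->] : is_derive t 1 f (f' t) by apply: df'; rewrite !ltW.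
Qed.

End interval_integrals.

(** * Pointwise differentiation rules *)

Section pointwise_derivatives.
Context {R : realType}.
Implicit Types (f g : R -> R) (x c : R).

Lemma is_derive1D f g x a b : is_derive x 1 f a -> is_derive x 1 g b ->
  is_derive x 1 (fun t => f t + g t) (a + b).
Proof. exact: is_deriveD. Qed.

Lemma is_derive1B f g x a b : is_derive x 1 f a -> is_derive x 1 g b ->
  is_derive x 1 (fun t => f t - g t) (a - b).
Proof. exact: is_deriveB. Qed.

Lemma is_derive1M f g x a b : is_derive x 1 f a -> is_derive x 1 g b ->
  is_derive x 1 (fun t => f t * g t) (a * g x + f x * b).
Proof.
by move=> fa gb; apply: is_derive_eq (is_deriveM fa gb) _; rewrite addrC mulrC.
Qed.

Lemma is_derive1Z f x c a : is_derive x 1 f a ->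
  is_derive x 1 (fun t => c * f t) (c * a).
Proof. by move=> fa; exact: (is_deriveZ c fa). Qed.

Lemma is_derive1_affine c d x : is_derive x 1 (fun t => c * t + d) c.
Proof.
have := is_derive1D (is_derive1Z c (is_derive_id x 1)) (is_derive_cst d x 1).
by rewrite mulr1 addr0.
Qed.

Lemma is_derive1_comp_affine f c d x a : is_derive (c * x + d) 1 f a ->
  is_derive x 1 (fun t => f (c * t + d)) (c * a).
Proof.
move=> fa; rewrite mulrC.
exact: (@is_derive1_comp _ f (fun t => c * t + d) x _ _ fa (is_derive1_affine c d x)).
Qed.

Lemma is_derive1_inv x : x != 0 -> is_derive x 1 (fun t : R => t^-1) (- x ^- 2).
Proof.
move=> x0; apply: is_derive_eq (is_deriveV _ (is_derive_id x 1)) _ => //.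
by rewrite scaler1.
Qed.

Lemma is_derive1_continuous f x a : is_derive x 1 f a -> {for x, continuous f}.
Proof.
by move=> [fa _]; apply/differentiable_continuous/derivable1_diffP.
Qed.

Lemma continuous_is_derive1 (f f' : R -> R) : (forall t : R, is_derive t 1 f (f' t)) ->
  continuous f.
Proof. by move=> df t; exact: is_derive1_continuous (df t). Qed.

Lemma is_derive1_eq f f' x a b : is_derive x 1 f a -> f =1 f' -> a = b ->
  is_derive x 1 f' b.
Proof. by move=> fa /funext <- <-. Qed.

Lemma is_derive1E f g : (forall x, is_derive x 1 f (g x)) -> f^`()%classic = g.
Proof. by move=> fg; apply/funext => x; rewrite derive1E; have [_ ->] := fg x. Qed.

End pointwise_derivatives.

(** * Smooth functions: flat functions, a bump and a step *)

Section smooth_functions.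
Context {R : realType}.
Implicit Types (f g : R -> R) (p : {poly R}) (x c d : R).

(* Closed under differentiation, which gives smoothness of products without a
   Leibniz formula for higher derivatives. *)
Inductive smooth_alg : (R -> R) -> Prop :=
| SmoothBase f : smooth f -> smooth_alg f
| SmoothAdd f g : smooth_alg f -> smooth_alg g -> smooth_alg (fun t => f t + g t)
| SmoothMul f g : smooth_alg f -> smooth_alg g -> smooth_alg (fun t => f t * g t).

Lemma smooth_derive1 f : smooth f -> smooth f^`()%classic.
Proof. by move=> sf n x; rewrite -iterSr; exact: sf. Qed.

Lemma smooth_is_derive f x : smooth f -> is_derive x 1 f (f^`()%classic x).
Proof. by move=> sf; rewrite derive1E; exact/derivableP/(sf 0%N). Qed.

Lemma smooth_continuous f : smooth f -> continuous f.
Proof. by move=> sf x; exact: is_derive1_continuous (smooth_is_derive x sf). Qed.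

Lemma smooth_alg_derive f : smooth_alg f ->
  exists2 g, smooth_alg g & forall x, is_derive x 1 f (g x).
Proof.
elim=> {f} [f sf|f g sf [f' sf' ff'] sg [g' sg' gg']|f g sf [f' sf' ff'] sg [g' sg' gg']].
- exists f^`()%classic; first exact/SmoothBase/smooth_derive1.
  by move=> x; exact: smooth_is_derive.
- exists (fun t => f' t + g' t); first exact: SmoothAdd.
  by move=> x; exact: is_derive1D.
- exists (fun t => f' t * g t + f t * g' t).
    by apply: SmoothAdd; apply: SmoothMul.
  by move=> x; exact: is_derive1M.
Qed.

Lemma smooth_alg_smooth f : smooth_alg f -> smooth f.
Proof.
move=> sf n; elim: n f sf => [f|n IH f] /smooth_alg_derive[g sg fg] x.
  by have [] := fg x.
by rewrite iterSr (is_derive1E fg); exact: IH.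
Qed.

Lemma smoothM f g : smooth f -> smooth g -> smooth (fun t => f t * g t).
Proof. by move=> sf sg; apply/smooth_alg_smooth/SmoothMul; exact: SmoothBase. Qed.

Lemma smoothD f g : smooth f -> smooth g -> smooth (fun t => f t + g t).
Proof. by move=> sf sg; apply/smooth_alg_smooth/SmoothAdd; exact: SmoothBase. Qed.

Lemma smooth_cst c : smooth (fun=> c).
Proof.
have it n : exists k, iter n (@derive1 R R) (fun=> c) = (fun=> k).
  elim: n => [|n [k IH]]; first by exists c.
  exists 0; rewrite iterS IH; apply/is_derive1E => x; exact: is_derive_cst.
by move=> n x; have [k ->] := it n; exact: derivable_cst.
Qed.

Lemma smooth_primitive f g : (forall x, is_derive x 1 f (g x)) -> smooth g ->
  smooth f.
Proof.
move=> fg sg [|n] x; first by have [] := fg x.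
by rewrite iterSr (is_derive1E fg); exact: sg.
Qed.

Lemma smooth_comp_affine f c d : smooth f -> smooth (fun t => f (c * t + d)).
Proof.
move=> sf.
have it n : iter n (@derive1 R R) (fun t => f (c * t + d))
          = (fun t => c ^+ n * iter n (@derive1 R R) f (c * t + d)).
  elim: n => [|n IH]; first by apply/funext => t; rewrite expr0 mul1r.
  rewrite iterS IH; apply/is_derive1E => x.
  rewrite exprSr -mulrA; apply: is_derive1Z; apply: is_derive1_comp_affine.
  by rewrite iterS derive1E; exact/derivableP/sf.
move=> n x; rewrite it.
have [] // : is_derive x 1 (fun t => c ^+ n * iter n (@derive1 R R) f (c * t + d))
   (c ^+ n * (c * (iter n.+1 (@derive1 R R) f (c * x + d)))).
apply: is_derive1Z; apply: is_derive1_comp_affine.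
by rewrite iterS derive1E; exact/derivableP/sf.
Qed.

(** Each monomial satisfies y^i <= i! exp y by the exponential series. Used at y = 1/x, where it
    makes exp (-1/x) beat every power of 1/x. *)
Lemma horner_le_expR p : exists2 C : R, 0 <= C &
  forall y : R, 0 <= y -> `|p.[y]| <= C * expR y.
Proof.
exists (\sum_(i < size p) `|p`_i| * (i`!)%:R).
  by apply: sumr_ge0 => i _; rewrite mulr_ge0.
move=> y y0; rewrite horner_coef (le_trans (ler_norm_sum _ _ _))// mulr_suml.
apply: ler_sum => i _; rewrite normrM normrX (ger0_norm y0) -mulrA ler_wpM2l//.
rewrite mulrC -ler_pdivrMr ?ltr0n ?fact_gt0//.
case: (nat_of_ord i) => [|k]; last first.
  by apply: le_trans (expR_ge1Dxn k y0); rewrite lerDr.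
by rewrite expr0 fact0 divr1 (le_trans _ (expR_ge1Dx y))// lerDl.
Qed.

(** The polynomial parameter makes the family closed under differentiation: deriving p(1/x) exp
    (-1/x) replaces p by X^2 (p - p'). *)
Definition flat p x : R := if 0 < x then p.[x^-1] * expR (- x^-1) else 0.

(** The exponential bound applied to X^2 p gains a factor x^2. Quadratic decay at the origin makes
    the difference quotient there tend to 0. *)
Lemma flat_sqr_bound p : exists2 C : R, 0 <= C &
  forall x, `|flat p x| <= C * x ^+ 2.
Proof.
have [C C0 HC] := horner_le_expR ('X^2 * p); exists C => // x.
rewrite /flat; case: ifPn => x0; last by rewrite normr0 mulr_ge0// sqr_ge0.
have xV0 : 0 <= x^-1 by rewrite invr_ge0 ltW.
have := HC _ xV0; rewrite hornerM hornerXn !normrM ger0_norm ?exprn_ge0//.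
rewrite (gtr0_norm (expR_gt0 _)) expRN.
rewrite -ler_pdivrMr ?expR_gt0// => H.
rewrite -ler_pdivrMr ?exprn_gt0// mulrC mulrA -exprVn.
by [].
Qed.

Lemma is_derive_flat p x :
  is_derive x 1 (flat p) (flat ('X^2 * (p - p^`())) x).
Proof.
have [x0|x0|->] := ltgtP x 0.
- apply: (@near_eq_is_derive _ _ _ (cst 0)).
    near=> z; rewrite /flat ifF//; apply/negbTE; rewrite -leNgt ltW//.
    by near: z; exact: lt_nbhsl.
  rewrite /flat ifF; last by apply/negbTE; rewrite -leNgt ltW.
  exact: is_derive_cst.
- apply: (@near_eq_is_derive _ _ _ (fun t : R => p.[t^-1] * expR (- t^-1) : R)).
    near=> z; rewrite /flat ifT//.
    by near: z; exact: lt_nbhsr.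
  have xn0 : x != 0 by rewrite gt_eqF.
  have dV := is_derive1_inv xn0.
  have d1 := @is_derive1_comp _ (horner p) _ x _ _ (is_derive_poly p x^-1) dV.
  have d2 := @is_derive1_comp _ expR _ x _ _ (is_derive_expR (- x^-1)) (is_deriveN dV).
  apply: is_derive1_eq (is_derive1M d1 d2) _ _ => //=.
  rewrite /flat x0 !hornerE/= exprVn; ring.
- rewrite /flat ltxx -/(flat p).
  have [C C0 HC] := flat_sqr_bound p.
  have cv : (fun h : R => h^-1 *: ((flat p \o shift (0:R)) (h *: (1:R)) - flat p 0)) @ 0^' --> (0:R).
    apply/cvgrPdist_le => e e0; near=> h.
    have h0 : h != 0 by near: h; exact: nbhs_dnbhs_neq.
    have -> : flat p 0 = 0 by rewrite /flat ltxx.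
    rewrite sub0r normrN subr0 /= addr0 /GRing.scale/= mulr1 normrM normfV.
    rewrite ler_pdivrMl ?normr_gt0// (le_trans (HC _))//.
    rewrite -real_normK ?num_real// expr2 mulrCA ler_wpM2l//.
    rewrite (le_trans (ler_wpM2r _ (_ : C <= C + 1)))// ?lerDl// mulrC.
    rewrite -ler_pdivlMr ?ltr_wpDl// ltW//.
    by near: h; apply: dnbhs0_lt; rewrite divr_gt0// ltr_wpDl.
  split; first by apply/cvg_ex; exists 0.
  by apply/cvg_lim.
Unshelve. all: by end_near. Qed.

Lemma smooth_flat p : smooth (flat p).
Proof.
move=> n x; suff [q ->] : exists q, iter n (@derive1 R R) (flat p) = flat q.
  by have [] := is_derive_flat q x.
elim: n => [|n [q IH]]; first by exists p.
exists ('X^2 * (q - q^`())); rewrite iterS IH; apply/is_derive1E => y.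
exact: is_derive_flat.
Qed.

(** exp (-1/x) exp (-1/(1 - x)) on ]0, 1[ and zero elsewhere; [1 - x] is spelled in the affine form
    [c * t + d] of the composition lemmas. *)
Definition bump x : R := flat 1 x * flat 1 (-1 * x + 1).

Lemma smooth_bump : smooth bump.
Proof.
apply: smoothM; first exact: smooth_flat.
by apply: (@smooth_comp_affine (flat 1) (-1) 1); apply: smooth_flat.
Qed.

Lemma bump_gt0 x : 0 < x < 1 -> 0 < bump x.
Proof.
move=> /andP[x0 x1]; have x1' : 0 < -1 * x + 1 by lra.
have E y : (1 : {poly R}).[y] = 1 by rewrite hornerE.
by rewrite /bump /flat x0 x1' !E !mul1r mulr_gt0 ?expR_gt0.
Qed.

Lemma bump_out x : ~~ (0 < x < 1) -> bump x = 0.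
Proof.
rewrite /bump /flat; case: ifP => [x0|_]; last by rewrite mul0r.
case: ifP => [x1|_]; last by rewrite mulr0.
by move: x1; rewrite mulN1r addrC subr_gt0 => ->.
Qed.

Lemma bump_ge0 x : 0 <= bump x.
Proof.
by have [/bump_gt0/ltW//|/bump_out ->] := boolP (0 < x < 1).
Qed.

Lemma integrable_bump : lebesgue_measure.-integrable setT (EFin \o bump).
Proof.
have cb := smooth_continuous smooth_bump.
have -> : bump = bump \_ (`[0, 1]).
  apply/funext => x; rewrite patchE; case: ifPn => //.
  rewrite notin_setE/= in_itv/= => /negP nx.
  by apply: bump_out; apply: contra nx => /andP[/ltW -> /ltW ->].
rewrite -restrict_EFin; apply/integrable_restrict => //=; rewrite setTI.
by apply: continuous_itv_integrable; exact: continuous_subspaceT.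
Qed.

(** [S] is the primitive of [bump] normalized to rise from 0 to 1 and [r] is its density. After
    rescaling, [S] approximates a Heaviside function and [r] a Dirac mass. *)
Lemma smooth_step : exists S r : R -> R,
  [/\ smooth S, forall x, is_derive x 1 S (r x), continuous r &
   [/\ forall x, 0 <= r x, forall x, x <= 0 -> S x = 0, forall x, 1 <= x -> S x = 1,
       forall x, 0 <= S x <= 1 & forall x, ~~ (0 < x < 1) -> r x = 0]].
Proof.
(* Integrating from minus infinity makes [B] differentiable at every real point by one use of the
   fundamental theorem. *)
pose B x : R := \int[lebesgue_measure]_(t in [set` Interval -oo%O (BRight x)]) bump t.
have cb := smooth_continuous smooth_bump.
have dB x : is_derive x 1 B (bump x).
  have ib : lebesgue_measure.-integrable [set` Interval -oo%O (BRight (x + 1))] (EFin \o bump).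
    by apply: integrableS integrable_bump.
  have xx : x < x + 1 by rewrite ltrDl.
  have [d1 d2] := @continuous_FTC1 R bump -oo%O x (x + 1) xx ib (ltNyr x) (cb x).
  by apply: DeriveDef; [exact: d1|rewrite -derive1E; exact: d2].
have cB : continuous B by move=> x; exact: is_derive1_continuous (dB x).
have incB x y : x <= y -> exists2 c, x <= c <= y & B y - B x = bump c * (y - x).
  move=> xy; have [] := @MVT_segment R B bump x y xy (fun t _ => dB t).
    exact: continuous_subspaceT.
  by move=> c; rewrite in_itv/= => cxy E; exists c.
have B01 : 0 < B 1 - B 0.
  have [] := @MVT R B bump 0 1 ltr01 (fun t _ => dB t).
    exact: continuous_subspaceT.
  by move=> c; rewrite in_itv/= => c01 ->; rewrite subr0 mulr1 bump_gt0.
have Bge0 x y : x <= y -> 0 <= B y - B x.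
  by move=> xy; have [c _ ->] := incB _ _ xy; rewrite mulr_ge0 ?bump_ge0// subr_ge0.
have B0 x : x <= 0 -> B x = B 0.
  move=> x0; have [c /andP[_ c0] E] := incB _ _ x0.
  have : B 0 - B x = 0.
    by rewrite E bump_out ?mul0r// negb_and -leNgt c0.
  by move/eqP; rewrite subr_eq0 => /eqP.
have B1 x : 1 <= x -> B x = B 1.
  move=> x1; have [c /andP[c1 _] E] := incB _ _ x1.
  have : B x - B 1 = 0.
    by rewrite E bump_out ?mul0r// negb_and -!leNgt c1 orbT.
  by move/eqP; rewrite subr_eq0 => /eqP.
pose k := (B 1 - B 0)^-1.
have k0 : 0 < k by rewrite invr_gt0.
pose S x := k * (B x - B 0).
have S0 x : x <= 0 -> S x = 0 by move=> /B0 E; rewrite /S E subrr mulr0.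
have S1 x : 1 <= x -> S x = 1.
  by move=> /B1 E; rewrite /S E mulVf// gt_eqF.
have dS x : is_derive x 1 S (k * bump x).
  apply: is_derive1Z; apply: is_derive1_eq (is_derive1B (dB x) (is_derive_cst (B 0) x 1)) _ _ => //.
  by rewrite subr0.
have sr : smooth (fun x => k * bump x).
  by apply: smoothM; [exact: smooth_cst|exact: smooth_bump].
exists S, (fun x => k * bump x); split => //.
- exact: smooth_primitive dS sr.
- exact: smooth_continuous.
split => //.
- by move=> x; rewrite mulr_ge0 ?bump_ge0// ltW.
- move=> x; have [x0|/ltW x0] := leP x 0; first by rewrite S0// lexx ler01.
  have [x1|/ltW x1] := leP 1 x; first by rewrite S1// lexx ler01.
  apply/andP; split; first by rewrite mulr_ge0 ?Bge0// ltW.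
  by rewrite /S mulrC ler_pdivrMr// mul1r lerD2r -subr_ge0 Bge0.
- by move=> x x01; rewrite bump_out// mulr0.
Qed.

End smooth_functions.

(** * Weak derivatives and absolutely continuous functions *)

Section weak_derivatives.
Context {R : realType}.
Local Notation mu := (@lebesgue_measure R).
Implicit Types (f g h : R -> R) (a b c d x y z : R) (D E : set R).

Lemma integral_subset D E f : E `<=` D ->
  (forall t, D t -> ~ E t -> f t = 0) ->
  (\int[mu]_(t in D) (f t)%:E = \int[mu]_(t in E) (f t)%:E)%E.
Proof.
move=> ED f0; rewrite integral_mkcond [RHS]integral_mkcond.
congr (integral _ _ _); apply/funext => t; rewrite !patchE.
case: (boolP (t \in E)) => [|/negP]; rewrite inE => Et.
  by rewrite mem_set//; exact: ED.
by case: ifP => //; rewrite inE => Dt; rewrite f0.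
Qed.

Lemma integral_fine x y f : mu.-integrable `[x, y] (EFin \o f) ->
  (\int[mu]_(t in `[x, y]) (f t)%:E)%E = (\int[mu]_(t in `[x, y]) f t)%:E.
Proof.
by move=> fi; rewrite /Rintegral fineK//; apply: integrable_fin_num fi.
Qed.

Lemma integral_oo_fine x y f : mu.-integrable `[x, y] (EFin \o f) ->
  (\int[mu]_(t in `]x, y[) (f t)%:E)%E = (\int[mu]_(t in `[x, y]) f t)%:E.
Proof.
move=> fi; rewrite -integral_fine// -(@integral_itv_bndoo _ x y _ true false)//.
apply: measurable_funS (measurable_int mu fi) => //; exact: subset_itv_oo_cc.
Qed.

Lemma near_natS_gt (u : R) : \forall n \near \oo, u < n.+1%:R.
Proof.
near=> n; rewrite (@lt_trans _ _ n%:R) ?ltr_nat//.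
by near: n; exact: nbhs_infty_gtr.
Unshelve. all: by end_near. Qed.

Lemma continuous_rescale (k c : R) (r : R -> R) : continuous r ->
  continuous (fun t => k * r (k * t - c)).
Proof.
move=> cr t; apply: (@continuousM _ _ (cst k)); first exact: cst_continuous.
apply: (@continuous_comp _ _ _ (fun t => k * t - c) r); last exact: cr.
exact: is_derive1_continuous (is_derive1_affine k (- c) t).
Qed.

(** The kernel is one-sided: it has mass one and lives in ]z, z + 1/(n+1)[. Hence [z] may be the
    left endpoint but must stay strictly below the right one. *)
Lemma mollifier_cvg (S r : R -> R) f x y z :
  (forall t : R, is_derive t 1 S (r t)) -> continuous r -> (forall t, 0 <= r t) ->
  (forall t : R, t <= 0 -> S t = 0) -> (forall t : R, 1 <= t -> S t = 1) ->
  (forall t : R, ~~ (0 < t < 1) -> r t = 0) ->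
  {within `[x, y], continuous f} -> x <= z -> z < y ->
  (\int[mu]_(t in `[x, y]) (f t * (n.+1%:R * r (n.+1%:R * t - n.+1%:R * z))))
    @[n --> \oo] --> f z.
Proof.
move=> dS cr r0 S0 S1 rout cf xz zy; have xy := le_lt_trans xz zy.
apply/cvgrPdist_le => e e0.
have [d d0 Hd] : exists2 d, 0 < d & forall t, z <= t -> t <= y -> t - z < d ->
    `|f t - f z| <= e.
  have cfz : {within `[z, y], continuous f}.
    by apply: continuous_subspaceW cf; apply: subset_itvScc.
  have [_ cz _] := (continuous_within_itvP f zy).1 cfz.
  move/cvgrPdist_le : cz => /(_ _ e0) [d /= d0 Hd].
  exists d => // t zt ty tzd; move: zt; rewrite le_eqVlt => /predU1P[<-|zt].
    by rewrite subrr normr0 ltW.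
  rewrite distrC; apply: Hd => //=; rewrite distrC ger0_norm// subr_ge0 ltW//.
near=> n.
have n0 : 0 < n.+1%:R :> R by rewrite ltr0n.
have n1 : n.+1%:R^-1 < Num.min d (y - z).
  rewrite invf_plt ?posrE ?lt_min ?d0 ?subr_gt0//.
  near: n; exact: near_natS_gt.
have {n1}[nd nyz] : n.+1%:R^-1 < d /\ n.+1%:R^-1 < y - z.
  by move: n1; rewrite lt_min => /andP.
set k : R := n.+1%:R in n0 nd nyz *.
pose rn t := k * r (k * t - k * z).
have crn : continuous rn by exact: continuous_rescale.
have dSn (t : R) : is_derive t 1 (fun t => S (k * t - k * z)) (rn t).
  exact: is_derive1_comp_affine.
have [irn Srn] := primitive_on_C1 (ltW xy) (fun t _ => dSn t) (continuous_subspaceT crn).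
have rn1 : \int[mu]_(t in `[x, y]) rn t = 1.
  rewrite -(Srn x y (lexx x) (ltW xy) (lexx y)) S1; last first.
    by rewrite -mulrBr mulrC -ler_pdivrMr// mul1r ltW.
  by rewrite S0 ?subr0// -mulrBr pmulr_rle0// subr_le0.
have rn0 t : 0 <= rn t by rewrite mulr_ge0// ltW.
have ifr : mu.-integrable `[x, y] (EFin \o (fun t => f t * rn t)).
  exact: integrable_itv_continuousM.
have iz : mu.-integrable `[x, y] (EFin \o (fun t => f z * rn t)).
  exact: integrable_itvZ.
(* As [rn] has mass one, [f z] and [e] are themselves integrals against [rn], and only a pointwise
   comparison on its support remains. *)
have -> : f z - \int[mu]_(t in `[x, y]) (f t * rn t)
        = \int[mu]_(t in `[x, y]) (f z * rn t - f t * rn t).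
  by rewrite RintegralB// RintegralZl// rn1 mulr1.
have -> : e = \int[mu]_(t in `[x, y]) (e * rn t).
  by rewrite RintegralZl// rn1 mulr1.
apply: Rintegral_itv_abs_le; [exact: integrable_itvB|exact: integrable_itvZ|].
move=> t /andP[xt ty]; rewrite -mulrBl normrM (ger0_norm (rn0 _)).
have [kt|kt] := boolP (0 < k * t - k * z < 1); last first.
  by rewrite /rn rout// !mulr0.
rewrite ler_wpM2r// distrC; move: kt.
rewrite -mulrBr pmulr_rgt0// subr_gt0 mulrC -ltr_pdivlMr// mul1r => /andP[zt ktz].
by apply: Hd => //; [exact: ltW|exact: lt_trans nd].
Unshelve. all: by end_near. Qed.

(** At [u = 0] the limit is 0, because S 0 = 0: the limiting Heaviside function is
    left-continuous. *)
Lemma cvg_step (S : R -> R) (u : R) :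
  (forall t : R, t <= 0 -> S t = 0) -> (forall t : R, 1 <= t -> S t = 1) ->
  S (n.+1%:R * u) @[n --> \oo] --> (if 0 < u then 1 else 0 : R).
Proof.
move=> S0 S1; case: ifPn => u0.
  apply: cvg_near_cst; near=> n; apply: S1.
  rewrite -ler_pdivrMr// mul1r ltW//.
  near: n; exact: near_natS_gt.
apply: cvg_near_cst; near=> n; apply: S0.
by rewrite pmulr_rle0// leNgt.
Unshelve. all: by end_near. Qed.

(* Test against a smooth approximation of the indicator function of [[x, y]]. *)
Lemma weak_deriv_increment D f g x y y' : x <= y -> y < y' ->
  `[x, y'] `<=` D -> weak_deriv D f g ->
  {within `[x, y'], continuous f} -> mu.-integrable `[x, y'] (EFin \o g) ->
  f y - f x = \int[mu]_(t in `[x, y]) g t.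
Proof.
move=> xy yy' xyD wfg cf gi; have xy' := le_lt_trans xy yy'.
have [S [r [sS dS cr [r0 S0 S1 S01 rout]]]] := @smooth_step R.
pose phi n t := S (n.+1%:R * t - n.+1%:R * x) - S (n.+1%:R * t - n.+1%:R * y).
pose rn z n t := n.+1%:R * r (n.+1%:R * t - n.+1%:R * z).
have sphi n : smooth (phi n).
  have -> : phi n = (fun t => S (n.+1%:R * t + - (n.+1%:R * x)) +
       (-1) * S (n.+1%:R * t + - (n.+1%:R * y))).
    by apply/funext => t; rewrite mulN1r.
  apply: smoothD; first exact: smooth_comp_affine.
  by apply: smoothM; [exact: smooth_cst|exact: smooth_comp_affine].
have dphi n (t : R) : is_derive t 1 (phi n) (rn x n t - rn y n t).
  by apply: is_derive1B; apply: is_derive1_comp_affine.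
have crn z n : continuous (rn z n) by exact: continuous_rescale.
have phi1 n t : `|phi n t| <= 1.
  rewrite /phi; have /andP[? ?] := S01 (n.+1%:R * t - n.+1%:R * x).
  have /andP[? ?] := S01 (n.+1%:R * t - n.+1%:R * y).
  by rewrite ler_norml; apply/andP; split; lra.
have mphi n : measurable_fun `[x, y'] (phi n).
  apply: continuous_itv_measurable; apply: continuous_subspaceT.
  by move=> t; exact: is_derive1_continuous (dphi n t).
have gphi n : mu.-integrable `[x, y'] (EFin \o (fun t => phi n t * g t)).
  by apply: (@integrable_itv_bddM _ _ _ 1).
have fr z n : mu.-integrable `[x, y'] (EFin \o (fun t => f t * rn z n t)).
  apply: integrable_itv_continuousM => //.
  by apply: continuous_itv_integrable; exact: continuous_subspaceT.
pose A z n := \int[mu]_(t in `[x, y']) (f t * rn z n t).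
pose C n := \int[mu]_(t in `[x, y']) (phi n t * g t).
have ABC : \forall n \near \oo, A y n - A x n = C n.
  near=> n.
  have k0 : 0 < n.+1%:R :> R by rewrite ltr0n.
  have kyy : n.+1%:R^-1 < y' - y.
    rewrite invf_plt ?posrE ?subr_gt0//; near: n; exact: near_natS_gt.
  have ky' t : y' < t -> 1 <= n.+1%:R * t - n.+1%:R * y.
    move=> y't; rewrite -mulrBr mulrC -ler_pdivrMr// mul1r.
    by rewrite ltW// (lt_trans kyy)// ltrD2r.
  have kx' t : y' < t -> 1 <= n.+1%:R * t - n.+1%:R * x.
    move=> /ky'/le_trans; apply; rewrite lerD2l lerN2 ler_wpM2l//.
  have k_le0 z t : t < z -> n.+1%:R * t - n.+1%:R * z <= 0.
    by move=> tz; rewrite -mulrBr pmulr_rle0// subr_le0 ltW.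
  have out t : ~~ (x <= t <= y') -> phi n t = 0 /\ rn x n t - rn y n t = 0.
    rewrite negb_and -!ltNge => /orP[tx|ty].
      have ty := lt_le_trans tx xy.
      rewrite /phi /rn !S0 ?k_le0// !rout ?mulr0 ?subrr//;
        by rewrite negb_and -leNgt k_le0.
    rewrite /phi /rn !S1 ?ky' ?kx'// !rout ?mulr0 ?subrr//;
      by rewrite negb_and -!leNgt ?ky' ?kx'// orbT.
  have tphi : test_fun D (phi n).
    split => //; exists `[x, y']%classic; split => //; first exact: segment_compact.
    by move=> t /=; rewrite in_itv/= => /negP/out[].
  have := wfg _ tphi.
  rewrite (is_derive1E (dphi n)).
  rewrite (@integral_subset D _ (fun t => f t * _) xyD); last first.
    by move=> t _ /=; rewrite in_itv/= => /negP/out[_ ->]; rewrite mulr0.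
  rewrite (@integral_subset D _ (fun t => g t * _) xyD); last first.
    by move=> t _ /=; rewrite in_itv/= => /negP/out[-> _]; rewrite mulr0.
  rewrite integral_fine; last first.
    apply: eq_integrable_itv (integrable_itvB (fr x n) (fr y n)) => t _.
    by rewrite mulrBr.
  rewrite integral_fine; last first.
    by apply: eq_integrable_itv (gphi n) => t _; rewrite mulrC.
  rewrite -EFinN => -[].
  rewrite (@eq_Rintegral_itv _ _ _ _ (fun t => f t * rn x n t - f t * rn y n t)); last first.
    by move=> t _; rewrite mulrBr.
  rewrite RintegralB// -/(A x n) -/(A y n).
  rewrite (@eq_Rintegral_itv _ _ _ _ (fun t => phi n t * g t)); last first.
    by move=> t _; rewrite mulrC.
  by rewrite -/(C n) => E; rewrite -(opprK (C n)) -E; ring.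
have cA z : x <= z -> z < y' -> A z n @[n --> \oo] --> f z.
  by move=> xz zy; apply: (mollifier_cvg dS).
have cAA : (A y n - A x n) @[n --> \oo] --> f y - f x.
  by apply: cvgB; apply: cA.
(* The limit of [phi n] is the indicator of ]x, y], half-open because both steps vanish at their own
   jump. *)
pose L t := ((EFin \o g) \_ `]x, y]) t.
have mg : measurable_fun `[x, y'] (EFin \o g) by exact: measurable_int gi.
have [|||||_ _ cC] := @dominated_convergence _ _ _ mu `[x, y']%classic (measurable_itv _)
   (fun n t => (phi n t * g t)%:E) L (fun t => `|g t|%:E).
- by move=> n; exact: measurable_int (gphi n).
- apply/measurable_restrict => //; exact: measurable_funS mg.
- apply: aeW => t txy.
  have -> : L t = (((if 0 < t - x then 1 else 0) - (if 0 < t - y then 1 else 0)) * g t)%:E.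
    rewrite /L patchE !subr_gt0.
    case: ifPn; rewrite ?notin_setE ?inE/= in_itv/=.
      by move=> /andP[-> ty]; rewrite ltNge ty/= subr0 mul1r.
    have [xt|xt] := ltP x t => /=.
      by move=> /negP; rewrite -ltNge => ->; rewrite subrr mul0r.
    by move=> _; rewrite ltNge (le_trans xt)//= subrr mul0r.
  apply: cvg_EFin; first by near=> n.
  apply: cvgM; last exact: cvg_cst.
  rewrite /phi; apply: cvgB.
    rewrite (_ : (fun n => _) = (fun n => S (n.+1%:R * (t - x)))); first exact: cvg_step.
    by apply/funext => n; rewrite mulrBr.
  rewrite (_ : (fun n => _) = (fun n => S (n.+1%:R * (t - y)))); first exact: cvg_step.
  by apply/funext => n; rewrite mulrBr.
- exact: (integrable_norm gi).
- apply: aeW => t n _; rewrite /= lee_fin normrM ler_piMl//.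
have LE : (\int[mu]_(t in `[x, y']) L t = (\int[mu]_(t in `[x, y]) g t)%:E)%E.
  rewrite /L -integral_mkcondr setIidr; last first.
    by apply: subset_itvScc; rewrite bnd_simp// ltW.
  have gxy : mu.-integrable `[x, y] (EFin \o g).
    by apply: (integrable_sub_itv gi) => //; exact: ltW.
  rewrite -integral_fine// integral_itv_obnd_cbnd//.
  by apply: measurable_int (integrableS _ _ _ gxy) => //; apply: subset_itvScc; rewrite bnd_simp.
have cC' : C n @[n --> \oo] --> \int[mu]_(t in `[x, y]) g t.
  rewrite LE in cC; move/fine_cvg : cC.
  by rewrite [X in X @ _ --> _](_ : _ = C).
apply: (@cvg_unique _ (@Rhausdorff R) ((A y n - A x n) @[n --> \oo])) => //.
apply: cvg_trans cC'; apply: near_eq_cvg.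
by apply: filterS ABC => n ->.
Unshelve. all: by end_near. Qed.

(** Increments strictly inside ]c, d[ leave the room that the mollified indicators require. The
    difference between [f] and the integral of [g] is then constant on ]c, d[, and its continuity
    carries this to both endpoints. *)
Lemma weak_deriv_primitive D f g c d : c < d ->
  `]c, d[ `<=` D -> weak_deriv D f g ->
  {within `[c, d], continuous f} -> mu.-integrable `[c, d] (EFin \o g) ->
  primitive_on c d f g.
Proof.
move=> cd cdD wfg cf gi.
have inc x y : c < x -> x <= y -> y < d -> f y - f x = \int[mu]_(t in `[x, y]) g t.
  move=> cx xy yd; pose y' := (y + d) / 2.
  have yy' : y < y' by rewrite /y'; lra.
  have y'd : y' < d by rewrite /y'; lra.
  apply: (@weak_deriv_increment D f g x y y') => //.
  - apply: subset_trans cdD; apply: subset_itv; rewrite bnd_simp//.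
  - by apply: continuous_subspaceW cf; apply: subset_itvScc; rewrite bnd_simp ltW.
  - by apply: (integrable_sub_itv gi); exact: ltW.
have [_ primP] := primitive_on_integral gi.
pose P x := \int[mu]_(t in `[c, x]) g t.
pose H x := f x - P x.
have cH : {within `[c, d], continuous H}.
  move=> x; apply: (@continuousB _ _ (subspace `[c, d])); first exact: cf.
  exact: (primitive_on_continuous (ltW cd) (primitive_on_integral gi)).
have [_ Hc Hd] := (continuous_within_itvP H cd).1 cH.
pose m := (c + d) / 2.
have cm : c < m by rewrite /m; lra.
have md : m < d by rewrite /m; lra.
have Hm x : c < x -> x < d -> H x = H m.
  move=> cx xd; have [xm|/ltW mx] := leP x m.
    have := inc x m cx xm md; rewrite -(primP x m (ltW cx) xm (ltW md)) => E.
    by rewrite /H /P; move: E; lra.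
  have := inc m x cm mx xd; rewrite -(primP m x (ltW cm) mx (ltW xd)) => E.
  by rewrite /H /P; move: E; lra.
have Hcm : H c = H m.
  apply: (@cvg_unique _ (@Rhausdorff R) (H @ c^'+)) => //.
  by apply: cvg_near_cst; near=> x; apply: Hm.
have Hdm : H d = H m.
  apply: (@cvg_unique _ (@Rhausdorff R) (H @ d^'-)) => //.
  by apply: cvg_near_cst; near=> x; apply: Hm.
have HE x : c <= x -> x <= d -> H x = H m.
  rewrite le_eqVlt => /predU1P[<-//|cx].
  by rewrite le_eqVlt => /predU1P[->//|xd]; exact: Hm.
split=> // x y cx xy yd.
have := HE x cx (le_trans xy yd); rewrite -(HE y (le_trans cx xy) yd).
by rewrite -(primP x y)// /H /P; lra.
Unshelve. all: by end_near. Qed.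

(** Integrate the product rule for [f * phi]: a test function vanishes at both ends of the open
    interval. *)
Lemma primitive_on_weak_deriv c d f g : c < d ->
  primitive_on c d f g -> weak_deriv `]c, d[ f g.
Proof.
move=> cd fg phi [sphi [K [cK Kcd phi0]]].
have sdphi := smooth_derive1 sphi.
have phic : phi c = 0 by apply: phi0 => /Kcd; rewrite /= in_itv/= ltxx.
have phid : phi d = 0 by apply: phi0 => /Kcd; rewrite /= in_itv/= ltxx andbF.
have pphi : primitive_on c d phi phi^`()%classic.
  apply: primitive_on_C1; first exact: ltW.
    by move=> t _; exact: smooth_is_derive.
  by apply: continuous_subspaceT; exact: smooth_continuous.
have [_ /(_ c d (lexx c) (ltW cd) (lexx d))] := primitive_onM (ltW cd) fg pphi.
rewrite phic phid !mulr0 subrr.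
have gp : mu.-integrable `[c, d] (EFin \o (fun t => g t * phi t)).
  apply: (@eq_integrable_itv _ _ _ (fun t => phi t * g t)); first by move=> t _; rewrite mulrC.
  by apply: integrable_itv_continuousM fg.1; exact: continuous_subspaceT (smooth_continuous sphi).
have fp : mu.-integrable `[c, d] (EFin \o (fun t => f t * phi^`()%classic t)).
  apply: integrable_itv_continuousM; first exact: primitive_on_continuous (ltW cd) fg.
  by apply: continuous_itv_integrable; exact: continuous_subspaceT (smooth_continuous sdphi).
rewrite RintegralD// => /esym/eqP; rewrite addr_eq0 => /eqP E.
by rewrite !integral_oo_fine// -EFinN E opprK.
Qed.

End weak_derivatives.

(** * Square integrable functions *)

Section square_integrable.
Context {R : realType}.
Local Notation mu := (@lebesgue_measure R).
Implicit Types (f g h : R -> R) (a b c x y M : R) (D E : set (measurableTypeR R)).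

Lemma L2onE D f : measurable D ->
  L2on D f <-> measurable_fun D f /\ mu.-integrable D (EFin \o (fun t => f t ^+ 2)).
Proof.
move=> mD.
have E : (\int[mu]_(t in D) `|(f t ^+ 2)%:E| =
          \int[mu]_(t in D) (f t ^+ 2)%:E)%E.
  by apply: eq_integral => t _; rewrite /= ger0_norm// sqr_ge0.
split=> [[mf fi]|[mf /integrableP[_ fi]]]; split => //.
  apply/integrableP; split; last by rewrite E.
  by apply/measurable_EFinP; exact: measurable_funX.
by rewrite -E.
Qed.

Lemma L2on_mul D f g : measurable D -> L2on D f -> L2on D g ->
  mu.-integrable D (EFin \o (fun t => f t * g t)).
Proof.
move=> mD /(L2onE _ mD)[mf fi] /(L2onE _ mD)[mg gi].
apply: (@le_integrable _ _ _ mu D mD _ (EFin \o (fun t => f t ^+ 2 + g t ^+ 2))).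
- by apply/measurable_EFinP; exact: measurable_funM.
- move=> t _; rewrite /= lee_fin [leRHS]ger0_norm ?addr_ge0 ?sqr_ge0//.
  rewrite ler_norml; apply/andP; split; rewrite -subr_ge0.
    have -> : f t * g t - - (f t ^+ 2 + g t ^+ 2)
       = (f t ^+ 2 + g t ^+ 2 + (f t + g t) ^+ 2) / 2 by field.
    by rewrite divr_ge0// !addr_ge0// sqr_ge0.
  have -> : f t ^+ 2 + g t ^+ 2 - f t * g t
       = (f t ^+ 2 + g t ^+ 2 + (f t - g t) ^+ 2) / 2 by field.
  by rewrite divr_ge0// !addr_ge0// sqr_ge0.
- exact: (integrableD mD fi gi).
Qed.

Lemma L2onD D f g : measurable D -> L2on D f -> L2on D g ->
  L2on D (fun t => f t + g t).
Proof.
move=> mD Lf Lg; have fg := L2on_mul mD Lf Lg.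
have [mf fi] := (L2onE f mD).1 Lf; have [mg gi] := (L2onE g mD).1 Lg.
apply/L2onE => //; split; first exact: measurable_funD.
apply: eq_integrable (integrableD mD (integrableD mD fi gi) (integrableZl mD 2 fg)) => //.
move=> t _ /=.
have -> : (f t + g t) ^+ 2 = f t ^+ 2 + g t ^+ 2 + 2 * (f t * g t) by ring.
by rewrite EFinD EFinD EFinM.
Qed.

Lemma L2on_bddM D M h g : measurable D -> measurable_fun D h ->
  (forall t, D t -> `|h t| <= M) -> L2on D g -> L2on D (fun t => h t * g t).
Proof.
move=> mD mh hM /(L2onE _ mD)[mg gi]; apply/L2onE => //; split.
  exact: measurable_funM.
apply: (@le_integrable _ _ _ mu D mD _ (EFin \o (fun t => M ^+ 2 * g t ^+ 2))).
- by apply/measurable_EFinP; apply: measurable_funX; exact: measurable_funM.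
- move=> t Dt; have M0 : 0 <= M := le_trans (normr_ge0 _) (hM _ Dt).
  rewrite /= lee_fin ger0_norm ?sqr_ge0// ger0_norm; last first.
    by apply: mulr_ge0; exact: sqr_ge0.
  rewrite exprMn ler_wpM2r ?sqr_ge0// -[leLHS]real_normK ?num_real//.
  by rewrite ler_pXn2r ?nnegrE ?hM.
- exact: (integrableZl mD (M ^+ 2) gi).
Qed.

Lemma L2onS D E f : measurable D -> measurable E -> E `<=` D ->
  L2on D f -> L2on E f.
Proof.
move=> mD mE ED /(L2onE _ mD)[mf fi]; apply/L2onE => //; split.
  exact: measurable_funS mf.
exact: integrableS fi.
Qed.

Lemma L2on_oo_cc a b f : L2on `]a, b[ f -> L2on `[a, b] f.
Proof.
move=> [mf fi]; split; first exact: measurable_fun_itv_cc mf.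
rewrite (@integral_itv_bndoo _ a b _ true false)//.
by apply/measurable_EFinP; exact: measurable_funX.
Qed.

Lemma continuous_L2on a b f : {within `[a, b], continuous f} -> L2on `[a, b] f.
Proof.
move=> cf; apply/L2onE => //; split; first exact: continuous_itv_measurable.
apply: (integrable_itv_continuousM cf); exact: continuous_itv_integrable.
Qed.

Lemma L2on_continuousM a b h g : {within `[a, b], continuous h} ->
  L2on `[a, b] g -> L2on `[a, b] (fun t => h t * g t).
Proof.
move=> ch; have [M hM] := continuous_itv_bounded ch.
apply: (@L2on_bddM _ M) => //; first exact: continuous_itv_measurable.
Qed.

Lemma L2on_integrable a b f : L2on `[a, b] f ->
  mu.-integrable `[a, b] (EFin \o f).
Proof.
move=> Lf; have L1 : L2on `[a, b] (fun=> 1 : R).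
  by apply: continuous_L2on; exact: continuous_subspaceT (@cst_continuous _ _ _).
apply: eq_integrable_itv (L2on_mul _ L1 Lf) => // t _.
by rewrite mul1r.
Qed.

End square_integrable.

(** * Sine and cosine of absolutely continuous functions *)

Section trigonometric_primitives.
Context {R : realType}.
Implicit Types (f g F G : R -> R) (a b x y : R).

Lemma is_derive1_increment F G (u v : R) : (forall x : R, is_derive x 1 F (G x)) ->
  exists2 c, `|c - u| <= `|v - u| & F v - F u = G c * (v - u).
Proof.
move=> dF; have cF x y : {within `[x, y], continuous F}.
  by apply: continuous_subspaceT => z; exact: is_derive1_continuous (dF z).
have [uv|/ltW vu] := leP u v.
  have [c] := MVT_segment uv (fun z _ => dF z) (cF u v).
  rewrite in_itv/= => /andP[uc cv] E; exists c => //.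
  by rewrite !ger0_norm ?subr_ge0// lerD2r.
have [c] := MVT_segment vu (fun z _ => dF z) (cF v u).
rewrite in_itv/= => /andP[vc cu] E; exists c.
  by rewrite !ler0_norm ?subr_le0// !opprB lerD2l lerN2.
by rewrite -(opprB u v) mulrN -E opprB.
Qed.

Lemma is_derive1_lipschitz F G (K u v : R) : (forall x : R, is_derive x 1 F (G x)) ->
  (forall x, `|G x| <= K) -> `|F v - F u| <= K * `|v - u|.
Proof.
move=> /is_derive1_increment dF GK; have [c _ ->] := dF u v.
by rewrite normrM ler_wpM2r.
Qed.

(** The mean value theorem moves the increment to an intermediate point, and the Lipschitz bound
    compares the derivative there with the one at [u]. This is the first hypothesis of
    [primitive_on_comp]. *)
Lemma is_derive1_taylor F G (K u v : R) : (forall x : R, is_derive x 1 F (G x)) ->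
  0 <= K -> (forall x y, `|G y - G x| <= K * `|y - x|) ->
  `|F v - F u - G u * (v - u)| <= K * (v - u) ^+ 2.
Proof.
move=> /is_derive1_increment dF K0 GK; have [c cu ->] := dF u v.
rewrite -mulrBl normrM -[in leRHS]real_normK ?num_real// expr2 mulrA.
by rewrite ler_wpM2r// (le_trans (GK _ _))// ler_wpM2l.
Qed.

Lemma cos_lipschitz x y : `|cos y - cos x| <= 1 * `|y - x|.
Proof.
apply: (@is_derive1_lipschitz cos (fun z => - sin z)) => z.
by rewrite normrN sin_max.
Qed.

Lemma sin_lipschitz x y : `|sin y - sin x| <= 1 * `|y - x|.
Proof.
by apply: (@is_derive1_lipschitz sin cos) => z; exact: cos_max.
Qed.

Lemma primitive_on_sin a b f g : a <= b -> primitive_on a b f g ->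
  primitive_on a b (fun t => sin (f t)) (fun t => cos (f t) * g t).
Proof.
move=> ab; apply: (@primitive_on_comp _ a b 1) => //.
- by move=> u v; apply: (@is_derive1_taylor sin cos) => //; exact: cos_lipschitz.
- by move=> u v; exact: cos_lipschitz.
Qed.

Lemma primitive_on_cos a b f g : a <= b -> primitive_on a b f g ->
  primitive_on a b (fun t => cos (f t)) (fun t => - sin (f t) * g t).
Proof.
have lip x y : `|- sin y - - sin x| <= 1 * `|y - x|.
  by rewrite -opprD normrN sin_lipschitz.
move=> ab; apply: (@primitive_on_comp _ a b 1 f g cos (fun t => - sin t)) => //.
by move=> u v; apply: (@is_derive1_taylor cos (fun t => - sin t)).
Qed.

End trigonometric_primitives.

(** * Energy on a segment and on the truncated ray *)

Section energy_estimates.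
Context {R : realType}.
Local Notation mu := (@lebesgue_measure R).
Implicit Types (f g p q u : R -> R) (k L s x y : R).

Section harmonic_interpolation.
Variables (k L z0 z1 : R).

(** The solution of phi'' = - k^2 phi with values [z0] at 0 and [z1] at L, its arguments in the
    affine form [c * t + d]. *)
Definition hinterp (t : R) : R :=
  (z0 * sin (- k * t + k * L) + z1 * sin (k * t + 0)) / sin (k * L).

Definition hinterp' (t : R) : R :=
  k * (- z0 * cos (- k * t + k * L) + z1 * cos (k * t + 0)) / sin (k * L).

Lemma is_derive_hinterp (t : R) : is_derive t 1 hinterp (hinterp' t).
Proof.
rewrite /hinterp /hinterp'.
have d1 := is_derive1_comp_affine (is_derive_sin (- k * t + k * L)).
have d2 := is_derive1_comp_affine (is_derive_sin (k * t + 0)).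
have d3 := is_derive1D (is_derive1Z z0 d1) (is_derive1Z z1 d2).
apply: is_derive1_eq (is_derive1M d3 (is_derive_cst (sin (k * L))^-1 t 1)) _ _ => //=.
by rewrite mulr0 addr0; ring.
Qed.

Lemma is_derive_hinterp' (t : R) : is_derive t 1 hinterp' (- k ^+ 2 * hinterp t).
Proof.
rewrite /hinterp /hinterp'.
have d1 := is_derive1_comp_affine (is_derive_cos (- k * t + k * L)).
have d2 := is_derive1_comp_affine (is_derive_cos (k * t + 0)).
have d3 := is_derive1Z k (is_derive1D (is_derive1Z (- z0) d1) (is_derive1Z z1 d2)).
apply: is_derive1_eq (is_derive1M d3 (is_derive_cst (sin (k * L))^-1 t 1)) _ _ => //=.
by rewrite mulr0 addr0; ring.
Qed.

Lemma continuous_hinterp : continuous hinterp.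
Proof. exact: continuous_is_derive1 is_derive_hinterp. Qed.

Lemma continuous_hinterp' : continuous hinterp'.
Proof. exact: continuous_is_derive1 is_derive_hinterp'. Qed.

Lemma hinterp0 : sin (k * L) != 0 -> hinterp 0 = z0.
Proof. by move=> h; rewrite /hinterp !mulr0 !add0r sin0 mulr0 addr0 mulfK. Qed.

Lemma hinterpL : sin (k * L) != 0 -> hinterp L = z1.
Proof.
by move=> h; rewrite /hinterp mulNr addNr addr0 sin0 mulr0 add0r mulfK.
Qed.

Lemma hinterp'0 : hinterp' 0 = k * (z1 - z0 * cos (k * L)) / sin (k * L).
Proof. by rewrite /hinterp' !mulr0 !add0r cos0; congr (_ / _); ring. Qed.

Lemma hinterp'L : hinterp' L = k * (z1 * cos (k * L) - z0) / sin (k * L).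
Proof. by rewrite /hinterp' (mulNr k L) (addNr (k * L)) addr0 cos0; congr (_ / _); ring. Qed.

Lemma primitive_hinterp : 0 <= L -> primitive_on 0 L hinterp hinterp'.
Proof.
move=> L0; apply: primitive_on_C1 => //; first by move=> t _; exact: is_derive_hinterp.
by apply: continuous_subspaceT; exact: continuous_hinterp'.
Qed.

Lemma primitive_hinterp' : 0 <= L ->
  primitive_on 0 L hinterp' (fun t => - k ^+ 2 * hinterp t).
Proof.
move=> L0; apply: primitive_on_C1 => //; first by move=> t _; exact: is_derive_hinterp'.
apply: within_continuous_mul; first exact: within_continuous_cst.
by apply: continuous_subspaceT; exact: continuous_hinterp.
Qed.

(** The integrand is the derivative of phi phi', so the energy is a pure boundary term. *)
Lemma hinterp_energy : 0 <= L -> sin (k * L) != 0 ->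
  \int[mu]_(t in `[0, L]) (hinterp' t ^+ 2 - k ^+ 2 * hinterp t ^+ 2)
  = k / sin (k * L) * (cos (k * L) * (z0 ^+ 2 + z1 ^+ 2) - 2 * z0 * z1).
Proof.
move=> L0 sn0.
have [_ /(_ 0 L (lexx 0) L0 (lexx L))] :=
  primitive_onM L0 (primitive_hinterp L0) (primitive_hinterp' L0).
rewrite hinterp0// hinterpL// hinterp'0 hinterp'L => E.
rewrite (@eq_Rintegral_itv _ _ _ _
  (fun t => hinterp' t * hinterp' t + hinterp t * (- k ^+ 2 * hinterp t))).
  by rewrite -E; field.
by move=> t _; ring.
Qed.

End harmonic_interpolation.

(* Completing the square around the interpolating solution [phi] of
   [phi'' = - k ^ 2 phi] with the boundary values of [p]; the weight
   [g = k tan (k t - k L / 2)] solves [g' = k ^ 2 + g ^ 2] on all of [[0, L]]. *)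
Lemma harmonic_energy_bound k L p p' : 0 < k -> 0 < L -> k * L < pi ->
  primitive_on 0 L p p' -> L2on `[0, L] p' ->
  k / sin (k * L) * (cos (k * L) * (p 0 ^+ 2 + p L ^+ 2) - 2 * p 0 * p L)
  <= \int[mu]_(t in `[0, L]) (p' t ^+ 2 - k ^+ 2 * p t ^+ 2).
Proof.
move=> k0 L0 kL pp' Lp'; have L0' := ltW L0.
have sn0 : sin (k * L) != 0 by rewrite gt_eqF// sin_gt0_pi// mulr_gt0.
pose phi := hinterp k L (p 0) (p L); pose phi' := hinterp' k L (p 0) (p L).
pose g t := k * tan (k * t + - (k * L / 2)).
(* Centering by k L / 2 is what lets k L < pi keep the argument inside ]-pi/2, pi/2[, where the
   tangent is finite. *)
have cosn0 t : 0 <= t <= L -> cos (k * t + - (k * L / 2)) != 0.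
  move=> /andP[t0 tL]; rewrite gt_eqF// cos_gt0_pihalf//.
  have h1 : 0 <= k * t by rewrite mulr_ge0// ltW.
  have h2 : k * t <= k * L by rewrite ler_wpM2l// ltW.
  by apply/andP; split; lra.
have dg t : 0 <= t <= L -> is_derive t 1 g (k ^+ 2 + g t ^+ 2).
  move=> tL; have cn0 := cosn0 _ tL.
  apply: is_derive1_eq (is_derive1Z k (is_derive1_comp_affine (is_derive_tan cn0))) _ _ => //.
  by rewrite cos2_tan2// /g; ring.
have cg : {within `[0, L], continuous g}.
  apply: derivable_within_continuous => t; rewrite in_itv/= => tL.
  by have [] := dg _ tL.
have cgg : {within `[0, L], continuous (fun t => k ^+ 2 + g t ^+ 2)}.
  apply: within_continuous_add; first exact: within_continuous_cst.
  exact: (within_continuous_mul cg cg).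
have Pg : primitive_on 0 L g (fun t => k ^+ 2 + g t ^+ 2) by exact: primitive_on_C1.
have Pphi : primitive_on 0 L phi phi' := primitive_hinterp k (p 0) (p L) L0'.
have Pphi' : primitive_on 0 L phi' (fun t => - k ^+ 2 * phi t)
  := primitive_hinterp' k (p 0) (p L) L0'.
have Peta := primitive_onB pp' Pphi.
have P1 := primitive_onM L0' Pg (primitive_on_sqr L0' Peta).
have P2 := primitive_onM L0' Pphi' pp'.
have P3 := primitive_onM L0' Pphi Pphi'.
(* With eta = p - phi, this is 2 phi' p - phi phi' - g eta^2. The energy density minus its
   derivative is the square (eta' + g eta)^2, and eta vanishes at both ends, so [g] is absent from
   the boundary terms. *)
have PB := primitive_onB (primitive_onB (primitive_onZ 2 P2) P3) P1.
have [iB EB] := PB.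
have := EB 0 L (lexx 0) L0' (lexx L).
rewrite /phi /phi' hinterp0// hinterpL// hinterp'0 hinterp'L !subrr expr0n/= !mulr0 !subr0.
rewrite -/phi -/phi' => {}EB.
have -> : k / sin (k * L) * (cos (k * L) * (p 0 ^+ 2 + p L ^+ 2) - 2 * p 0 * p L)
  = 2 * (k * (p L * cos (k * L) - p 0) / sin (k * L) * p L) -
    p L * (k * (p L * cos (k * L) - p 0) / sin (k * L)) -
    (2 * (k * (p L - p 0 * cos (k * L)) / sin (k * L) * p 0) -
     p 0 * (k * (p L - p 0 * cos (k * L)) / sin (k * L))) by field.
rewrite EB; apply: le_Rintegral => //.
- have cp := primitive_on_continuous L0' pp'.
  apply: integrable_itvB; first by have [] := (L2onE p' (measurable_itv _)).1 Lp'.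
  apply: integrable_itvZ.
  by have [] := (L2onE p (measurable_itv _)).1 (continuous_L2on cp).
- move=> t _; rewrite -subr_ge0.
  set u := (X in 0 <= X).
  have -> : u = (p' t - phi' t + g t * (p t - phi t)) ^+ 2 by rewrite /u; ring.
  exact: sqr_ge0.
Qed.

(** Expanding the square leaves exactly the derivative of s u^2 / t, whose increment is the boundary
    term. The square is kept: the lower bound discards it, while the trial function has to estimate
    it; it vanishes for multiples of t^s. *)
Lemma hardy_identity s (N : R) u u' : 1 <= N ->
  primitive_on 1 N u u' -> L2on `[1, N] u' ->
  \int[mu]_(t in `[1, N]) (u' t ^+ 2 - (s - s ^+ 2) * (t ^- 2 * u t ^+ 2))
  = \int[mu]_(t in `[1, N]) (u' t - s * (t^-1 * u t)) ^+ 2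
    + s * u N ^+ 2 / N - s * u 1 ^+ 2.
Proof.
move=> N1 uu' Lu'.
have n0 t : 1 <= t <= N -> t != 0.
  by move=> /andP[t1 _]; rewrite gt_eqF// (lt_le_trans _ t1).
have dV t : 1 <= t <= N -> is_derive t 1 (fun t : R => t^-1) (- t ^- 2).
  by move=> /n0; exact: is_derive1_inv.
have cV : {within `[1, N], continuous (fun t : R => t^-1)}.
  apply: derivable_within_continuous => t; rewrite in_itv/= => tL.
  by have [] := dV _ tL.
have cV2 : {within `[1, N], continuous (fun t : R => - t ^- 2)}.
  rewrite (_ : (fun t => _) = (fun t : R => -1 * (t^-1 * t^-1))).
    apply: within_continuous_mul; first exact: within_continuous_cst.
    exact: (within_continuous_mul cV cV).
  by apply/funext => t; rewrite mulN1r -invfM.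
have PV : primitive_on 1 N (fun t : R => t^-1) (fun t => - t ^- 2).
  exact: primitive_on_C1.
have cu := primitive_on_continuous N1 uu'.
have L1 : L2on `[1, N] (fun t => t^-1 * u t).
  by apply: L2on_continuousM cV _; exact: continuous_L2on.
have L2 : L2on `[1, N] (fun t => u' t - s * (t^-1 * u t)).
  have := L2onD (measurable_itv _) Lu' (L2on_bddM (M := `|s|) (measurable_itv _)
    (measurable_cst (- s)) _ L1).
  rewrite (_ : (fun t => u' t + _) = (fun t => u' t - s * (t^-1 * u t))).
    by apply => t _; rewrite normrN.
  by apply/funext => t; rewrite mulNr.
have [iB EB] := primitive_onZ s (primitive_onM N1 PV (primitive_on_sqr N1 uu')).
have := EB 1 N (lexx 1) N1 (lexx N); rewrite invr1 mul1r => {}EB.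
have -> : s * u N ^+ 2 / N = s * (N^-1 * u N ^+ 2) by ring.
rewrite -addrA EB -RintegralD//; last first.
  by have [] := (L2onE _ (measurable_itv _)).1 L2.
by apply: eq_Rintegral_itv => t /n0 tn0; field.
Qed.

End energy_estimates.

(** * Lower bounds on the ray and on the magnetic circle *)

Section lower_bounds.
Context {R : realType}.
Local Notation mu := (@lebesgue_measure R).
Implicit Types (a p q u : R -> R) (k s : R).

(** In the identity on [1, N] both the square and s u(N)^2 / N are nonnegative. Dropping them gives
    a bound uniform in N, and N then goes to infinity. The weighted integrand is integrable because
    t^-2 <= 1 on the ray. *)
Lemma hardy_bound s u u' : 0 <= s -> H1 `]1, +oo[ u u' ->
  {within `[1, +oo[, continuous u} ->
  mu.-integrable `]1, +oo[ (EFin \o (fun t => t ^- 2 * u t ^+ 2)) /\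
  (s - s ^+ 2) * \int[mu]_(t in `]1, +oo[) (t ^- 2 * u t ^+ 2)
  <= \int[mu]_(t in `]1, +oo[) (u' t ^+ 2) + s * u 1 ^+ 2.
Proof.
have aux (X Y Z W U T : R) : X - Y = Z + W - U -> 0 <= Z -> 0 <= W -> X <= T ->
    Y <= T + U by lra.
move=> s0 [Lu Lu' wu] cu.
have mI : measurable (`]1, +oo[%classic : set (measurableTypeR R)) by [].
have [mu_ iu] := (L2onE u mI).1 Lu; have [mu' iu'] := (L2onE u' mI).1 Lu'.
have mw : measurable_fun (`](1 : R), +oo[%classic : set R) (fun t : R => t ^- 2 * u t ^+ 2).
  apply: measurable_funM; last exact: measurable_funX.
  apply: open_continuous_measurable_fun; first exact: interval_open.
  move=> t; rewrite inE/= in_itv/= andbT => t1.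
  rewrite (_ : (fun t : R => t ^- 2) = (fun t => t^-1 * t^-1)); last first.
    by apply/funext => z; rewrite -invfM.
  have tn0 : t != 0 by rewrite gt_eqF// (lt_trans _ t1).
  by apply: continuousM; exact: inv_continuous.
have iw : mu.-integrable `]1, +oo[ (EFin \o (fun t => t ^- 2 * u t ^+ 2)).
  apply: le_integrable iu => //; first exact/measurable_EFinP.
  move=> t; rewrite /= in_itv/= andbT => t1.
  have t0 : 0 < t by rewrite (lt_trans _ t1).
  rewrite lee_fin !ger0_norm ?sqr_ge0//; last first.
    by apply: mulr_ge0; [rewrite invr_ge0|]; exact: sqr_ge0.
  by rewrite ler_piMl ?sqr_ge0// invf_le1 ?exprn_gt0// exprn_ege1// ltW.
split=> //.
(* These half-open pieces increase to the ray, as monotone convergence requires; the piece for n = 0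
   is empty and is treated apart. *)
pose I n : set R := [set` Interval (BRight 1) (BRight (1 + n%:R))].
have bnd n : (s - s ^+ 2) * \int[mu]_(t in I n) (t ^- 2 * u t ^+ 2)
  <= \int[mu]_(t in `]1, +oo[) (u' t ^+ 2) + s * u 1 ^+ 2.
  have C0 : 0 <= \int[mu]_(t in `]1, +oo[) (u' t ^+ 2) + s * u 1 ^+ 2.
    by apply: addr_ge0; [apply: Rintegral_ge0 => t _|apply: mulr_ge0 => //]; exact: sqr_ge0.
  case: n => [|n].
    by rewrite /I addr0 set_itvoc0 Rintegral_set0 mulr0.
  set N : R := 1 + n.+1%:R; have N1 : 1 < N by rewrite /N ltrDl.
  have oc : `]1, N] `<=` `]1, +oo[ by apply: subset_itvl.
  have oo : `]1, N[ `<=` `]1, +oo[ by apply: subset_itvl.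
  have Lu'N : L2on `[1, N] u' by apply: L2on_oo_cc; exact: L2onS Lu'.
  have cuN : {within `[1, N], continuous u}.
    by apply: continuous_subspaceW cu; exact: subset_itvl.
  have Pu : primitive_on 1 N u u'.
    exact: (weak_deriv_primitive N1 oo wu cuN (L2on_integrable Lu'N)).
  have iwN : mu.-integrable `[1, N] (EFin \o (fun t => t ^- 2 * u t ^+ 2)).
    have L1 : L2on `[1, N] (fun t => t^-1 * u t).
      apply: (@L2on_oo_cc _ 1 N).
      apply: (@L2on_bddM _ _ 1) => //.
      - apply: open_continuous_measurable_fun; first exact: interval_open.
        move=> t; rewrite inE/= in_itv/= => /andP[t1 _].
        by apply: inv_continuous; rewrite gt_eqF// (lt_trans _ t1).
      - move=> t; rewrite /= in_itv/= => /andP[t1 _].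
        by rewrite ger0_norm ?invr_ge0 ?invf_le1 ?(lt_trans _ t1)// ltW// (lt_trans _ t1).
      - exact: L2onS Lu.
    have [_ ] := (L2onE _ (measurable_itv _)).1 L1.
    by apply: eq_integrable_itv => t _; rewrite exprMn -exprVn.
  have [_ iu'N] := (L2onE _ (measurable_itv _)).1 Lu'N.
  have := hardy_identity s (ltW N1) Pu Lu'N.
  rewrite RintegralB//; last exact: integrable_itvZ.
  rewrite RintegralZl// => E.
  have sq0 : 0 <= \int[mu]_(t in `[1, N]) (u' t - s * (t^-1 * u t)) ^+ 2.
    by apply: Rintegral_ge0 => t _; exact: sqr_ge0.
  have sN : 0 <= s * u N ^+ 2 / N.
    by apply: divr_ge0; [apply: mulr_ge0 => //; exact: sqr_ge0|rewrite ltW// (lt_trans _ N1)].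
  rewrite /I -/N Rintegral_itv_obnd_cbnd; last exact: integrableS iw.
  have le1 : \int[mu]_(t in `[1, N]) (u' t ^+ 2) <= \int[mu]_(t in `]1, +oo[) (u' t ^+ 2).
    rewrite -Rintegral_itv_obnd_cbnd; last exact: integrableS iu'.
    rewrite /Rintegral fine_le//.
    + by apply: integrable_fin_num => //; exact: integrableS iu'.
    + exact: integrable_fin_num.
    + apply: ge0_subset_integral => //; first exact: measurable_int iu'.
      by move=> t _; rewrite lee_fin sqr_ge0.
  exact: aux E sq0 sN le1.
have cv : \int[mu]_(t in I n) (t ^- 2 * u t ^+ 2) @[n --> \oo]
    --> \int[mu]_(t in `]1, +oo[) (t ^- 2 * u t ^+ 2).
  apply: fine_cvg.
  rewrite fineK; last exact: integrable_fin_num.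
  rewrite itv_bndy_bigcup_BRight.
  have ndI : nondecreasing_seq I.
    apply/nondecreasing_seqP => n; apply/subsetPset; apply: subset_itvl.
    by rewrite bnd_simp lerD2l ler_nat.
  have mwI n : measurable_fun (I n) (fun t : R => (t ^- 2 * u t ^+ 2)%:E).
    apply: measurable_funS (measurable_int _ iw) => //.
    exact: subset_itvl.
  apply: (@ge0_nondecreasing_set_cvg_integral _ (measurableTypeR R) R I
    (fun t => (t ^- 2 * u t ^+ 2)%:E) mu ndI _ mwI).
  - by move=> n; exact: measurable_itv.
  - by move=> n t _; rewrite lee_fin; apply: mulr_ge0; [rewrite invr_ge0|]; exact: sqr_ge0.
have {}cv : (s - s ^+ 2) * \int[mu]_(t in I n) (t ^- 2 * u t ^+ 2) @[n --> \oo]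
    --> (s - s ^+ 2) * \int[mu]_(t in `]1, +oo[) (t ^- 2 * u t ^+ 2).
  by apply: cvgM cv; exact: cvg_cst.
rewrite -(cvg_lim (@Rhausdorff R) cv); apply: limr_le.
  by apply/cvg_ex; eexists; exact: cv.
by near=> n; exact: bnd.
Unshelve. all: by end_near. Qed.

(* The gauge transformation [P + i Q = exp (- i A) (p + i q)], [A' = a], turns
   the magnetic energy into the free one, at the cost of the boundary twist
   [exp (- i A L)]. *)
Lemma magnetic_energy_bound k L a p q dp dq : 0 < k -> 0 < L -> k * L < pi ->
  L2on `[0, L] a -> primitive_on 0 L p dp -> primitive_on 0 L q dq ->
  L2on `[0, L] dp -> L2on `[0, L] dq -> p 0 = p L -> q 0 = q L ->
  k ^+ 2 * \int[mu]_(t in `[0, L]) (p t ^+ 2 + q t ^+ 2)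
  + 2 * k * (cos (k * L) - cos (\int[mu]_(t in `[0, L]) a t)) / sin (k * L)
    * (p 0 ^+ 2 + q 0 ^+ 2)
  <= \int[mu]_(t in `[0, L]) ((dq t - a t * p t) ^+ 2 + (dp t + a t * q t) ^+ 2).
Proof.
move=> k0 L0 kL La Pp Pq Ldp Ldq p0L q0L; have L0' := ltW L0.
have mI : measurable (`[0, L]%classic : set (measurableTypeR R)) by [].
have sn0 : 0 < sin (k * L) by rewrite sin_gt0_pi// mulr_gt0.
pose A t := \int[mu]_(z in `[0, t]) a z.
have PA : primitive_on 0 L A a by apply: primitive_on_integral; exact: L2on_integrable.
have A0 : A 0 = 0 by rewrite /A set_itv1 Rintegral_set1.
have Pc := primitive_on_cos L0' PA; have Ps := primitive_on_sin L0' PA.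
have cp := primitive_on_continuous L0' Pp; have cq := primitive_on_continuous L0' Pq.
have cc := primitive_on_continuous L0' Pc; have cs := primitive_on_continuous L0' Ps.
pose e1 t := dp t + a t * q t; pose e2 t := dq t - a t * p t.
have Le1 : L2on `[0, L] e1.
  rewrite (_ : e1 = (fun t => dp t + q t * a t)); last by apply/funext => t; rewrite mulrC.
  by apply: L2onD => //; exact: L2on_continuousM.
have Le2 : L2on `[0, L] e2.
  rewrite (_ : e2 = (fun t => dq t + (-1 * p t) * a t)); last first.
    by apply/funext => t; rewrite /e2; ring.
  apply: L2onD => //; apply: L2on_continuousM => //.
  by apply: within_continuous_mul cp; exact: within_continuous_cst.
pose P t := p t * cos (A t) + q t * sin (A t).
pose Q t := q t * cos (A t) + -1 * (p t * sin (A t)).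
pose P' t := cos (A t) * e1 t + sin (A t) * e2 t.
pose Q' t := cos (A t) * e2 t + (-1 * sin (A t)) * e1 t.
have PP : primitive_on 0 L P P'.
  apply: eq_primitive_on (primitive_onD (primitive_onM L0' Pp Pc) (primitive_onM L0' Pq Ps)) => // t _.
  by rewrite /P' /e1 /e2; ring.
have PQ : primitive_on 0 L Q Q'.
  apply: eq_primitive_on (primitive_onD (primitive_onM L0' Pq Pc)
    (primitive_onZ (-1) (primitive_onM L0' Pp Ps))) => // t _.
  by rewrite /Q' /e1 /e2; ring.
have LP' : L2on `[0, L] P' by apply: L2onD => //; exact: L2on_continuousM.
have LQ' : L2on `[0, L] Q'.
  apply: L2onD => //; first exact: L2on_continuousM.
  apply: L2on_continuousM => //.
  by apply: within_continuous_mul cs; exact: within_continuous_cst.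
have := lerD (harmonic_energy_bound k0 L0 kL PP LP') (harmonic_energy_bound k0 L0 kL PQ LQ').
have cP := primitive_on_continuous L0' PP; have cQ := primitive_on_continuous L0' PQ.
have iP : mu.-integrable `[0, L] (EFin \o (fun t => P' t ^+ 2 - k ^+ 2 * P t ^+ 2)).
  apply: integrable_itvB; first by have [] := (L2onE _ mI).1 LP'.
  by apply: integrable_itvZ; have [] := (L2onE _ mI).1 (continuous_L2on cP).
have iQ : mu.-integrable `[0, L] (EFin \o (fun t => Q' t ^+ 2 - k ^+ 2 * Q t ^+ 2)).
  apply: integrable_itvB; first by have [] := (L2onE _ mI).1 LQ'.
  by apply: integrable_itvZ; have [] := (L2onE _ mI).1 (continuous_L2on cQ).
rewrite -RintegralD//.
have ie : mu.-integrable `[0, L] (EFin \o (fun t => e2 t ^+ 2 + e1 t ^+ 2)).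
  apply: integrable_itvD; first by have [] := (L2onE _ mI).1 Le2.
  by have [] := (L2onE _ mI).1 Le1.
have ipq : mu.-integrable `[0, L] (EFin \o (fun t => p t ^+ 2 + q t ^+ 2)).
  apply: integrable_itvD; first by have [] := (L2onE _ mI).1 (continuous_L2on cp).
  by have [] := (L2onE _ mI).1 (continuous_L2on cq).
(* The gauge transformation is a rotation at each point, so P^2 + Q^2 = p^2 + q^2 and P'^2 + Q'^2 =
   e1^2 + e2^2. *)
rewrite (@eq_Rintegral_itv _ _ _ _
  (fun t => (e2 t ^+ 2 + e1 t ^+ 2) - k ^+ 2 * (p t ^+ 2 + q t ^+ 2))); last first.
  move=> t _; rewrite /P /Q /P' /Q'.
  transitivity ((cos (A t) ^+ 2 + sin (A t) ^+ 2) *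
     ((e2 t ^+ 2 + e1 t ^+ 2) - k ^+ 2 * (p t ^+ 2 + q t ^+ 2))); first by ring.
  by rewrite cos2Dsin2 mul1r.
rewrite RintegralB//; last exact: integrable_itvZ.
rewrite RintegralZl// lerBrDr => H; apply: le_trans H.
rewrite addrC lerD2r -/(A L) le_eqVlt; apply/orP; left; apply/eqP.
rewrite /P /Q A0 cos0 sin0 -p0L -q0L.
set c := cos (A L); set d := sin (A L).
have cd : c ^+ 2 + d ^+ 2 = 1 by exact: cos2Dsin2.
(* (P, Q) at L is (p, q) at 0 rotated by minus A L. In the sum of the cross terms of the two
   components the sine parts cancel, which leaves c = cos (A L). *)
have -> : k / sin (k * L) *
  (cos (k * L) * ((p 0 * 1 + q 0 * 0) ^+ 2 + (p 0 * c + q 0 * d) ^+ 2) -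
   2 * (p 0 * 1 + q 0 * 0) * (p 0 * c + q 0 * d)) +
  k / sin (k * L) *
  (cos (k * L) * ((q 0 * 1 + -1 * (p 0 * 0)) ^+ 2 + (q 0 * c + -1 * (p 0 * d)) ^+ 2) -
   2 * (q 0 * 1 + -1 * (p 0 * 0)) * (q 0 * c + -1 * (p 0 * d)))
  = k / sin (k * L) * (p 0 ^+ 2 + q 0 ^+ 2) *
   (cos (k * L) * (1 + (c ^+ 2 + d ^+ 2)) - 2 * c) by ring.
by rewrite cd; ring.
Qed.

End lower_bounds.

(** * Existence of a root of the equation defining [lam_star] *)

Section spectral_equation.
Context {R : realType}.
Implicit Types (b l k al : R).

Lemma cos_periodic_int (n : int) (x : R) : cos (x + twopi * n%:~R) = cos x.
Proof.
have per m y : cos (y + twopi * m%:R) = cos y :> R.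
  have -> : twopi * m%:R = (pi *+ 2) *+ m :> R.
    by rewrite -[RHS]mulr_natr -[pi *+ 2]mulr_natl.
  exact: (periodicn (@cosD2pi R)).
case: n => n; first exact: per.
by rewrite NegzE mulrNz mulrN -(per n.+1 (x - _)) subrK.
Qed.

Lemma dist_int_itv al : ~ (exists n : int, al = n%:~R) ->
  0 < dist_int al <= 2^-1.
Proof.
move=> nal; rewrite /dist_int /=.
set f := al - _.
have f0 : 0 < f.
  rewrite lt_neqAle subr_ge0 ge_floor// andbT eq_sym subr_eq0.
  by apply/eqP => E; apply: nal; exists (Num.floor al).
have f1 : f < 1.
  rewrite ltrBlDl; have := floorD1_gt al; rewrite intrD.
  by rewrite mulr1z.
rewrite lt_min f0 subr_gt0 f1/= ge_min.
by have [h|h] := leP f 2^-1 => //=; lra.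
Qed.

(** The energy bound sees the flux only through this cosine, which is even and 1-periodic; hence the
    constant for [dist_int al] also serves [al]. *)
Lemma cos_dist_int al : cos (twopi * dist_int al) = cos (twopi * al) :> R.
Proof.
rewrite /dist_int/=; set n := Num.floor al.
have E : cos (twopi * (al - n%:~R)) = cos (twopi * al).
  by rewrite -[RHS](cos_periodic_int (- n)) mulrNz mulrN mulrBr.
rewrite /Num.min; case: ifP => _ //.
rewrite -E -[RHS]cosN -[RHS](cos_periodic_int 1); congr cos.
by rewrite mulr1z; ring.
Qed.

(* The equation for [lambda = k^2], multiplied by [4 k] to stay continuous at 0. *)
Let G b k : R := 4 * k * (cos (twopi * k) - cos (twopi * b))
  - (1 - Num.sqrt (1 - 4 * k ^+ 2)) * sin (twopi * k).

Let sqrt_cont (x : R) : {for x, continuous (fun k : R => Num.sqrt (1 - 4 * k ^+ 2))}.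
Proof.
apply: (@continuous_comp _ _ _ (fun k : R => 1 - 4 * k ^+ 2)); last exact: sqrt_continuous.
apply: continuousB; first exact: cst_continuous.
apply: continuousM; first exact: cst_continuous.
exact: exprn_continuous.
Qed.

Let affine_cont (c x : R) : {for x, continuous (fun k : R => c * k)}.
Proof. by apply: continuousM; [exact: cst_continuous|exact: cvg_id]. Qed.

Let cos_cont (c x : R) : {for x, continuous (fun k : R => cos (c * k))}.
Proof.
by apply: (@continuous_comp _ _ _ (fun k : R => c * k) cos);
  [exact: affine_cont|exact: continuous_cos].
Qed.

Let sin_cont (c x : R) : {for x, continuous (fun k : R => sin (c * k))}.
Proof.
by apply: (@continuous_comp _ _ _ (fun k : R => c * k) sin);
  [exact: affine_cont|exact: continuous_sin].
Qed.

Let G_cont b : continuous (G b).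
Proof.
move=> x; apply: (@continuousB _ _ _ (fun k => 4 * k * (cos (twopi * k) - cos (twopi * b)))
  (fun k => (1 - Num.sqrt (1 - 4 * k ^+ 2)) * sin (twopi * k))); apply: continuousM.
- exact: affine_cont.
- by apply: continuousB; [exact: cos_cont|exact: cst_continuous].
- by apply: continuousB; [exact: cst_continuous|exact: sqrt_cont].
- exact: sin_cont.
Qed.

(** A number r in [0, 1] satisfies r^2 <= r, applied to the square root r. *)
Let sqrt_bound k : 0 <= k -> k <= 2^-1 -> 1 - Num.sqrt (1 - 4 * k ^+ 2) <= 4 * k ^+ 2.
Proof.
move=> k0 k2.
have x0 : 0 <= 1 - 4 * k ^+ 2 by nra.
have x1 : 1 - 4 * k ^+ 2 <= 1 by nra.
rewrite lerBlDr -lerBlDl.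
have := sqr_sqrtr x0; have := sqrtr_ge0 (1 - 4 * k ^+ 2).
set r := Num.sqrt _ => r0 E; move: x1; rewrite -E => r1.
have r2 : r <= 1 by nra.
by rewrite expr2 ler_piMr.
Qed.

Let twopi_gt0 : 0 < twopi :> R.
Proof. by rewrite /twopi mulr_gt0// pi_gt0. Qed.

(** The square root term is at most 4 k^2, so [G b k] is at least 4 k (cos (2 pi k) - cos (2 pi b) -
    k), and the bracket tends to 1 - cos (2 pi b) > 0 as k tends to 0. *)
Let G_pos b : 0 < b -> b <= 2^-1 -> exists k, [/\ 0 < k, k < b & 0 < G b k].
Proof.
move=> b0 b2.
have tb : twopi * b <= pi.
  by rewrite /twopi; have := pi_gt0 R; nra.
have cb : cos (twopi * b) < 1.
  have tb0 : 0 < twopi * b by exact: mulr_gt0.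
  have I1 : twopi * b \in `[0, pi] by rewrite in_itv/= tb ltW.
  have I2 : 0 \in `[0, pi : R] by rewrite in_itv/= lexx pi_ge0.
  by rewrite -[ltRHS](@cos0 R) (ltr_cos I2 I1).
have ch : {for (0 : R), continuous (fun k : R => cos (twopi * k) - k)}.
  by apply: continuousB; [exact: cos_cont|exact: cvg_id].
have [d /= d0 Hd] : \forall k \near (0 : R), cos (twopi * b) < cos (twopi * k) - k.
  by apply: (cvgr_gt _ ch); rewrite mulr0 cos0 subr0.
pose k := Num.min (d / 2) (b / 2).
have k0 : 0 < k by rewrite lt_min !divr_gt0.
have kd : k < d by rewrite gt_min; apply/orP; left; lra.
have kb : k < b by rewrite gt_min; apply/orP; right; lra.
exists k; split => //.
have Hk : cos (twopi * b) < cos (twopi * k) - k.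
  by apply: Hd; rewrite /= sub0r normrN gtr0_norm.
have k2 : k <= 2^-1 by rewrite ltW// (lt_le_trans kb).
have sb := sqrt_bound (ltW k0) k2.
have r1 : 0 <= 1 - Num.sqrt (1 - 4 * k ^+ 2).
  rewrite subr_ge0 -[leRHS]sqrtr1 ler_wsqrtr//.
  by rewrite lerBlDr lerDl mulr_ge0// sqr_ge0.
have sl := sin_le1 (twopi * k).
rewrite /G; move: r1 sb; set r := 1 - _ => r1 sb.
have : r * sin (twopi * k) <= 4 * k ^+ 2.
  by rewrite (le_trans _ sb)// ler_piMr.
set S := r * _ => HS.
have : 0 < 4 * k * (cos (twopi * k) - cos (twopi * b) - k).
  by rewrite mulr_gt0 ?mulr_gt0//; lra.
by nra.
Qed.

(** For b < 1/2 the choice k = b works, since only the negative term survives. At b = 1/2 that term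
    vanishes as well and b is itself a root; the double angle formulas then factor [G] as 2 cos (pi
    k) times [H], and [H] equals -1 at 1/2, so [G] is negative just below b. *)
Let G_neg b k0 : 0 < k0 -> k0 < b -> b <= 2^-1 ->
  exists k, [/\ k0 < k, k <= b & G b k < 0].
Proof.
move=> k00 k0b; have b0 := lt_trans k00 k0b.
rewrite le_eqVlt => /predU1P[bE|b2]; last first.
  exists b; split => //; rewrite /G subrr mulr0 sub0r oppr_lt0 mulr_gt0//.
    rewrite subr_gt0 -[ltRHS]sqrtr1 ltr_sqrt// ltrBlDr ltrDl.
    by rewrite mulr_gt0// exprn_gt0.
  rewrite sin_gt0_pi// mulr_gt0//= /twopi; have := pi_gt0 R; nra.
pose H (k : R) := 4 * k * cos (pi * k) - (1 - Num.sqrt (1 - 4 * k ^+ 2)) * sin (pi * k).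
have cH : {for (2^-1 : R), continuous H}.
  apply: (@continuousB _ _ _ (fun k => 4 * k * cos (pi * k))
    (fun k => (1 - Num.sqrt (1 - 4 * k ^+ 2)) * sin (pi * k))); apply: continuousM.
  - exact: affine_cont.
  - exact: cos_cont.
  - by apply: continuousB; [exact: cst_continuous|exact: sqrt_cont].
  - exact: sin_cont.
have H2 : H 2^-1 < 0.
  rewrite /H cos_pihalf sin_pihalf mulr0 sub0r mulr1 oppr_lt0.
  have -> : 1 - 4 * 2^-1 ^+ 2 = 0 :> R by field.
  by rewrite sqrtr0 subr0.
have [d /= d0 Hd] : \forall k \near (2^-1 : R), H k < 0 by exact: (cvgr_lt _ cH).
pose k := Num.max (b - d / 2) ((k0 + b) / 2).
have kb : k < b by rewrite gt_max; apply/andP; split; lra.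
have k0k : k0 < k by rewrite lt_max; apply/orP; right; lra.
have kd : b - d < k by rewrite lt_max; apply/orP; left; lra.
exists k; split => //; first exact: ltW.
have Hk : H k < 0 by apply: Hd; rewrite /= -bE gtr0_norm ?subr_gt0//; lra.
have p0 := pi_gt0 R.
have ck : 0 < cos (pi * k).
  have kk : 0 < k by exact: lt_trans k0k.
  by rewrite cos_gt0_pihalf//; apply/andP; split; nra.
have E1 : twopi * k = (pi * k) *+ 2 by rewrite /twopi -mulrA mulr_natl.
have E2 : twopi * b = pi by rewrite /twopi bE mulrAC mulfV// mul1r.
have -> : G b k = 2 * cos (pi * k) * H k.
  by rewrite /G E1 E2 cospi cos_mulr2n sin_mulr2n /H; ring.
by rewrite pmulr_rlt0// mulr_gt0.
Qed.

Lemma lam_star_eq_exists b : 0 < b -> b <= 2^-1 -> exists l, lam_star_eq b l.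
Proof.
move=> b0 b2; have [k0 [k00 k0b Gk0]] := G_pos b0 b2.
have [k1 [k01 k1b Gk1]] := G_neg k00 k0b b2.
have [] := @IVT _ (G b) k0 k1 0 (ltW k01).
- by apply: continuous_subspaceT; exact: G_cont.
- by rewrite ge_min le_max (ltW Gk0) (ltW Gk1) orbT.
move=> c; rewrite in_itv/= => /andP[k0c ck1] Gc.
have c0 : 0 < c by exact: lt_le_trans k0c.
(* The definition asks for l < b^2 strictly; c differs from k1 because [G] is negative there, and k1
   <= b. *)
have cb : c < b.
  rewrite (lt_le_trans _ k1b)// lt_neqAle ck1 andbT.
  by apply/eqP => E; move: Gk1; rewrite -E Gc ltxx.
exists (c ^+ 2); split.
- exact: exprn_gt0.
- by rewrite ltr_pXn2r ?nnegrE ?ltW.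
- rewrite sqrtr_sqr gtr0_norm//.
  move: Gc; rewrite /G; set S := sin _; set C := cos _; set B := cos _.
  set r := 1 - _ => E.
  have -> : r / (4 * c) * S = r * S / (4 * c) by ring.
  have -> : r * S = 4 * c * (C - B) by move/eqP: E; rewrite subr_eq0 => /eqP ->.
  by field; rewrite gt_eqF.
Qed.

(** Existence of a root excludes the default value 0 of [xget]; a flux outside the integers makes
    [dist_int al] positive. *)
Lemma lam_star_spec al : ~ (exists n : int, al = n%:~R) ->
  lam_star_eq (dist_int al) (lam_star al).
Proof.
move=> /dist_int_itv /andP[b0 b2]; have [l hl] := lam_star_eq_exists b0 b2.
rewrite /lam_star; by case: xgetP => [//|/(_ l)].
Qed.

End spectral_equation.

(** * Trial functions for sharpness *)

Section trial_functions.
Context {R : realType}.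
Local Notation mu := (@lebesgue_measure R).
Implicit Types (a p q u v : R -> R) (k s L N : R).

(** Equality case of [magnetic_energy_bound]: the inverse gauge transformation u = exp (i A) w
    applied to the interpolating solution w = P + i Q, normalized to u = 1 at the junction. *)
Lemma magnetic_trial k L a : 0 < k -> 0 < L -> k * L < pi -> L2on `[0, L] a ->
  exists p q dp dq,
    [/\ primitive_on 0 L p dp /\ primitive_on 0 L q dq,
        L2on `[0, L] dp /\ L2on `[0, L] dq,
        p 0 = 1 /\ p L = 1, q 0 = 0 /\ q L = 0 &
    \int[mu]_(t in `[0, L]) ((dq t - a t * p t) ^+ 2 + (dp t + a t * q t) ^+ 2)
    - k ^+ 2 * \int[mu]_(t in `[0, L]) (p t ^+ 2 + q t ^+ 2)
    = 2 * k * (cos (k * L) - cos (\int[mu]_(t in `[0, L]) a t)) / sin (k * L)].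
Proof.
move=> k0 L0 kL La; have L0' := ltW L0.
have mI : measurable (`[0, L]%classic : set (measurableTypeR R)) by [].
have sn0 : sin (k * L) != 0 by rewrite gt_eqF// sin_gt0_pi// mulr_gt0.
pose A t := \int[mu]_(z in `[0, t]) a z.
have PA : primitive_on 0 L A a by apply: primitive_on_integral; exact: L2on_integrable.
have A0 : A 0 = 0 by rewrite /A set_itv1 Rintegral_set1.
have Pc := primitive_on_cos L0' PA; have Ps := primitive_on_sin L0' PA.
have cc := primitive_on_continuous L0' Pc; have cs := primitive_on_continuous L0' Ps.
(* The data are w(0) = 1 and w(L) = exp (- i A L) = c - i d, so that u equals 1 at both ends. *)
pose c := cos (A L); pose d := sin (A L).
pose P := hinterp k L 1 c; pose P' := hinterp' k L 1 c.
pose Q := hinterp k L 0 (- d); pose Q' := hinterp' k L 0 (- d).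
have PP : primitive_on 0 L P P' := primitive_hinterp k 1 c L0'.
have PQ : primitive_on 0 L Q Q' := primitive_hinterp k 0 (- d) L0'.
have cont (f : R -> R) : continuous f -> {within `[0, L], continuous f} by exact: continuous_subspaceT.
have cP : {within `[0, L], continuous P} by apply: cont; exact: continuous_hinterp.
have cQ : {within `[0, L], continuous Q} by apply: cont; exact: continuous_hinterp.
have cP' : {within `[0, L], continuous P'} by apply: cont; exact: continuous_hinterp'.
have cQ' : {within `[0, L], continuous Q'} by apply: cont; exact: continuous_hinterp'.
pose p t := P t * cos (A t) + -1 * (Q t * sin (A t)).
pose q t := P t * sin (A t) + Q t * cos (A t).
pose dp t := (P' t * cos (A t) + -1 * (Q' t * sin (A t))) + (-1 * q t) * a t.
pose dq t := (P' t * sin (A t) + Q' t * cos (A t)) + p t * a t.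
have Pp : primitive_on 0 L p dp.
  apply: eq_primitive_on (primitive_onD (primitive_onM L0' PP Pc)
    (primitive_onZ (-1) (primitive_onM L0' PQ Ps))) => // t _.
  by rewrite /dp /q; ring.
have Pq : primitive_on 0 L q dq.
  apply: eq_primitive_on (primitive_onD (primitive_onM L0' PP Ps)
    (primitive_onM L0' PQ Pc)) => // t _.
  by rewrite /dq /p; ring.
have cp := primitive_on_continuous L0' Pp; have cq := primitive_on_continuous L0' Pq.
have ccst := @within_continuous_cst R `[0, L].
exists p, q, dp, dq; split.
- by [].
- split; apply: L2onD => //.
  + apply: continuous_L2on; apply: within_continuous_add.
      exact: within_continuous_mul.
    by apply: within_continuous_mul => //; exact: within_continuous_mul.
  + by apply: L2on_continuousM => //; exact: within_continuous_mul.
  + apply: continuous_L2on; apply: within_continuous_add;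
    exact: within_continuous_mul.
  + exact: L2on_continuousM.
- split; rewrite /p /P /Q ?hinterp0 ?hinterpL// ?A0 ?cos0 ?sin0; first by ring.
  by rewrite -/c -/d -[RHS](cos2Dsin2 (A L)) -/c -/d; ring.
- split; rewrite /q /P /Q ?hinterp0 ?hinterpL// ?A0 ?cos0 ?sin0; first by ring.
  by rewrite -/c -/d; ring.
have iP : mu.-integrable `[0, L] (EFin \o (fun t => P' t ^+ 2 - k ^+ 2 * P t ^+ 2)).
  apply: integrable_itvB; first by have [] := (L2onE _ mI).1 (continuous_L2on cP').
  by apply: integrable_itvZ; have [] := (L2onE _ mI).1 (continuous_L2on cP).
have iQ : mu.-integrable `[0, L] (EFin \o (fun t => Q' t ^+ 2 - k ^+ 2 * Q t ^+ 2)).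
  apply: integrable_itvB; first by have [] := (L2onE _ mI).1 (continuous_L2on cQ').
  by apply: integrable_itvZ; have [] := (L2onE _ mI).1 (continuous_L2on cQ).
have ipq : mu.-integrable `[0, L] (EFin \o (fun t => p t ^+ 2 + q t ^+ 2)).
  apply: integrable_itvD; first by have [] := (L2onE _ mI).1 (continuous_L2on cp).
  by have [] := (L2onE _ mI).1 (continuous_L2on cq).
have E t : (dq t - a t * p t) ^+ 2 + (dp t + a t * q t) ^+ 2 = P' t ^+ 2 + Q' t ^+ 2.
  transitivity ((cos (A t) ^+ 2 + sin (A t) ^+ 2) * (P' t ^+ 2 + Q' t ^+ 2)).
    by rewrite /dp /dq; ring.
  by rewrite cos2Dsin2 mul1r.
have E' t : p t ^+ 2 + q t ^+ 2 = P t ^+ 2 + Q t ^+ 2.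
  transitivity ((cos (A t) ^+ 2 + sin (A t) ^+ 2) * (P t ^+ 2 + Q t ^+ 2)).
    by rewrite /p /q; ring.
  by rewrite cos2Dsin2 mul1r.
have ie : mu.-integrable `[0, L]
    (EFin \o (fun t => (dq t - a t * p t) ^+ 2 + (dp t + a t * q t) ^+ 2)).
  apply: (@eq_integrable_itv _ _ _ (fun t => P' t ^+ 2 + Q' t ^+ 2)).
    by move=> t _; rewrite E.
  apply: integrable_itvD; first by have [] := (L2onE _ mI).1 (continuous_L2on cP').
  by have [] := (L2onE _ mI).1 (continuous_L2on cQ').
rewrite -RintegralZl// -RintegralB//; last exact: integrable_itvZ.
rewrite (@eq_Rintegral_itv _ _ _ _
  (fun t => (P' t ^+ 2 - k ^+ 2 * P t ^+ 2) + (Q' t ^+ 2 - k ^+ 2 * Q t ^+ 2))); last first.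
  by move=> t _; rewrite E E'; ring.
rewrite RintegralD// !hinterp_energy// -/(A L) -/c.
have cd : d ^+ 2 = 1 - c ^+ 2 by rewrite -(cos2Dsin2 (A L)) -/c -/d; ring.
by rewrite sqrrN cd; field.
Qed.

Lemma L2on_patch (D E : set (measurableTypeR R)) u v : measurable D -> measurable E ->
  E `<=` D -> (forall t, E t -> u t = v t) -> (forall t, D t -> ~ E t -> u t = 0) ->
  L2on E v -> L2on D u.
Proof.
move=> mD mE ED uv u0 [mv iv].
have uE : {in D, v \_ E =1 u}.
  move=> t; rewrite inE => Dt; rewrite patchE.
  case: (boolP (t \in E)) => [|/negP]; rewrite inE => Et; first by rewrite uv.
  by rewrite u0.
split.
  apply: eq_measurable_fun uE _; apply/measurable_restrict => //.
  by apply: measurable_funS mv => //; exact: subIsetr.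
rewrite (integral_subset ED); last by move=> t Dt Et; rewrite u0// expr0n.
rewrite (_ : (\int[mu]_(t in E) _)%E = (\int[mu]_(t in E) (v t ^+ 2)%:E)%E)//.
by apply: eq_integral => t; rewrite inE => Et; rewrite uv.
Qed.

Lemma integral_half_line N (f g : R -> R) : mu.-integrable `[1, N] (EFin \o g) ->
  (forall t, 1 <= t <= N -> f t = g t) -> (forall t, N < t -> f t = 0) ->
  (\int[mu]_(t in `]1%R, +oo[) (f t)%:E)%E = (\int[mu]_(t in `[1, N]) g t)%:E.
Proof.
move=> ig fg f0.
have oc : `]1, N] `<=` `]1, +oo[ by apply: subset_itvl.
have occ : `]1, N] `<=` `[1, N] by apply: subset_itvScc; rewrite bnd_simp.
rewrite (integral_subset oc); last first.
  move=> t; rewrite /= !in_itv/= andbT => -> /negP; rewrite -ltNge; exact: f0.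
rewrite -integral_fine// -integral_itv_obnd_cbnd; last first.
  exact: measurable_funS (measurable_int mu ig).
apply: eq_integral => t; rewrite inE/= in_itv/= => /andP[t1 tN].
by rewrite fg// (ltW t1).
Qed.

(** Extension by zero creates no jump at N because v N = 0. In the integration by parts this kills
    the boundary term at N, and the test function kills the one at 1. *)
Lemma compactly_supported_H1 N u u' v v' : 1 < N -> primitive_on 1 N v v' ->
  L2on `[1, N] v' -> v N = 0 ->
  (forall t, 1 <= t <= N -> u t = v t) -> (forall t, N < t -> u t = 0) ->
  (forall t, 1 <= t <= N -> u' t = v' t) -> (forall t, N < t -> u' t = 0) ->
  H1 `]1, +oo[ u u'.
Proof.
move=> N1 Pv Lv' vN uv u0 uv' u0'.
have oc : `]1, N] `<=` `]1, +oo[ by apply: subset_itvl.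
have occ : `]1, N] `<=` `[1, N] by apply: subset_itvScc; rewrite bnd_simp.
have cv := primitive_on_continuous (ltW N1) Pv.
have inE1 t : `]1, N]%classic t -> 1 <= t <= N.
  by rewrite /= in_itv/= => /andP[/ltW -> ->].
have out t : `](1 : R), +oo[%classic t -> ~ `]1, N]%classic t -> N < t.
  by rewrite /= !in_itv/= andbT => -> /negP; rewrite -ltNge.
split.
- apply: (@L2on_patch _ `]1, N]%classic _ v) => //.
  + by move=> t /inE1; exact: uv.
  + by move=> t Dt Et; apply: u0; exact: out.
  + by apply: (@L2onS _ `[1, N]%classic) => //; exact: continuous_L2on.
- apply: (@L2on_patch _ `]1, N]%classic _ v') => //.
  + by move=> t /inE1; exact: uv'.
  + by move=> t Dt Et; apply: u0'; exact: out.
  + exact: (@L2onS _ `[1, N]%classic).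
move=> phi [sphi [K [cK Kcd phi0]]].
have sdphi := smooth_derive1 sphi.
have phi1 : phi 1 = 0 by apply: phi0 => /Kcd; rewrite /= in_itv/= ltxx.
have pphi : primitive_on 1 N phi phi^`()%classic.
  apply: primitive_on_C1; first exact: ltW.
    by move=> t _; exact: smooth_is_derive.
  by apply: continuous_subspaceT; exact: smooth_continuous.
have [_ /(_ 1 N (lexx 1) (ltW N1) (lexx N))] := primitive_onM (ltW N1) Pv pphi.
rewrite phi1 vN mulr0 mul0r subrr.
have gp : mu.-integrable `[1, N] (EFin \o (fun t => v' t * phi t)).
  apply: (@eq_integrable_itv _ _ _ (fun t => phi t * v' t)); first by move=> t _; rewrite mulrC.
  by apply: integrable_itv_continuousM Pv.1; exact: continuous_subspaceT (smooth_continuous sphi).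
have fp : mu.-integrable `[1, N] (EFin \o (fun t => v t * phi^`()%classic t)).
  apply: integrable_itv_continuousM => //.
  by apply: continuous_itv_integrable; exact: continuous_subspaceT (smooth_continuous sdphi).
rewrite RintegralD// => /esym/eqP; rewrite addr_eq0 => /eqP E.
rewrite (integral_half_line fp); last 2 first.
  by move=> t /uv ->.
  by move=> t /u0 ->; rewrite mul0r.
rewrite (integral_half_line gp); last 2 first.
  by move=> t /uv' ->.
  by move=> t /u0' ->; rewrite mul0r.
by rewrite -EFinN E opprK.
Qed.

(** From (M + 1)^r <= (2 M)^r <= 2 M^r the ratio is at most 2 / M^(1 - r). The choice of [M] makes
    M^(1 - r) exceed 2 / d. *)
Lemma exists_large_powR (r d : R) : 0 <= r -> r < 1 -> 0 < d ->
  exists2 M : R, 2 <= M & (M + 1) `^ r / M <= d.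
Proof.
move=> r0 r1 d0; pose c := 1 - r; have c0 : 0 < c by rewrite /c; lra.
pose B := 2 / d + 1.
have B0 : 0 < B by rewrite /B addr_gt0// divr_gt0.
pose M := B `^ c^-1 + 2.
have M2 : 2 <= M by rewrite lerDr powR_ge0.
have M0 : 0 < M by exact: lt_le_trans M2.
exists M => //.
have Mc : B <= M `^ c.
  have {1}-> : B = (B `^ c^-1) `^ c by rewrite -powRrM mulVf ?gt_eqF// powRr1// ltW.
  apply: ge0_ler_powR; [exact: ltW|by rewrite nnegrE powR_ge0|by rewrite nnegrE ltW|].
  by rewrite lerDl.
have M1 : (M + 1) `^ r <= (2 * M) `^ r.
  by apply: ge0_ler_powR; rewrite ?nnegrE//; lra.
have M3 : (2 * M) `^ r <= 2 * M `^ r.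
  rewrite powRM//; last exact: ltW.
  rewrite ler_wpM2r ?powR_ge0//.
  by apply: ler1_powR => //; [rewrite ler1n|exact: ltW].
have M4 : M `^ r * M `^ c = M.
  rewrite -powRD; last by apply/implyP => _; rewrite gt_eqF.
  by rewrite /c addrC subrK powRr1// ltW.
rewrite ler_pdivrMr// (le_trans M1)// (le_trans M3)// -[in leRHS]M4.
rewrite mulrCA mulrC ler_wpM2l ?powR_ge0//.
rewrite mulrC -ler_pdivrMr//.
by apply: le_trans Mc; rewrite /B lerDl.
Qed.

Lemma Rintegral_cst_itv (x y c : R) : x <= y ->
  \int[mu]_(t in `[x, y]) c = c * (y - x).
Proof.
move=> xy.
have [_ /(_ x y (lexx x) xy (lexx y)) <-] : primitive_on x y (fun t => c * t + 0) (fun=> c).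
  by apply: primitive_on_C1 => // [t _|]; [exact: is_derive1_affine|exact: within_continuous_cst].
by ring.
Qed.

(* The trial function is [t^s] times the affine cutoff from [1] at [t = 1] to [0]
   at [t = M + 1]; the cutoff costs at most [(M + 1)^(2 s) / M]. *)
Lemma hardy_trial s (d : R) : 0 <= s -> 2 * s < 1 -> 0 < d ->
  exists u u', [/\ H1 `]1, +oo[ u u', {within `[1, +oo[, continuous u}, u 1 = 1 &
    exists X Y, [/\ (\int[mu]_(t in `]1%R, +oo[) (u' t ^+ 2)%:E)%E = X%:E,
      (\int[mu]_(t in `]1%R, +oo[) (t ^- 2 * u t ^+ 2)%:E)%E = Y%:E,
      X - (s - s ^+ 2) * Y <= d - s & 16^-1 <= Y]].
Proof.
move=> s0 s1 d0.
have s2 : 0 <= 2 * s by rewrite mulr_ge0.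
have [M M2 HM] := exists_large_powR s2 s1 d0.
have M0 : 0 < M by exact: lt_le_trans M2.
pose N := M + 1; have N1 : 1 < N by rewrite /N; lra.
pose w (t : R) : R := - M^-1 * t + (1 + M^-1).
have wN : w N = 0 by rewrite /w /N; field; rewrite gt_eqF.
have w1 : w 1 = 1 by rewrite /w; ring.
have wE t : w t = M^-1 * (N - t) by rewrite /w /N; field; rewrite gt_eqF.
pose v (t : R) : R := t `^ s * w t.
pose v' (t : R) : R := s * t `^ (s - 1) * w t + t `^ s * (- M^-1).
(* The positive part of [w], written with an absolute value, makes continuity on the whole ray
   immediate. *)
pose u (t : R) : R := t `^ s * (2^-1 * (w t + `|w t|)).
pose u' (t : R) : R := if t <= N then v' t else 0.
have wpos (t : R) : t <= N -> 0 <= w t.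
  by move=> tN; rewrite wE mulr_ge0// ?subr_ge0// invr_ge0 ltW.
have dpow (r t : R) : 1 <= t -> is_derive t 1 (fun t : R => t `^ r) (r * t `^ (r - 1)).
  by move=> t1; apply: is_derive1_powR; exact: lt_le_trans t1.
have dw (t : R) : is_derive t 1 w (- M^-1) by exact: is_derive1_affine.
have dv (t : R) : 1 <= t <= N -> is_derive t 1 v (v' t).
  by move=> /andP[t1 _]; exact: (is_derive1M (dpow s t t1) (dw t)).
have cw : continuous w by exact: continuous_is_derive1 dw.
have cpow r : {within `[1, N], continuous (fun t : R => t `^ r)}.
  apply: derivable_within_continuous => t; rewrite in_itv/= => /andP[t1 _].
  by have [] := dpow r t t1.
have cv' : {within `[1, N], continuous v'}.
  apply: within_continuous_add.
    apply: within_continuous_mul; last exact: continuous_subspaceT.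
    by apply: within_continuous_mul => //; exact: within_continuous_cst.
  by apply: within_continuous_mul => //; exact: within_continuous_cst.
have Pv : primitive_on 1 N v v' by apply: primitive_on_C1 => //; exact: ltW.
have Lv' : L2on `[1, N] v' by exact: continuous_L2on.
have vN : v N = 0 by rewrite /v wN mulr0.
have v1 : v 1 = 1 by rewrite /v w1 powR1 mulr1.
have uv (t : R) : 1 <= t <= N -> u t = v t.
  by move=> /andP[_ tN]; rewrite /u /v ger0_norm ?wpos//; field.
have u0 (t : R) : N < t -> u t = 0.
  move=> Nt; rewrite /u ler0_norm ?subrr ?mulr0//.
  by rewrite wE pmulr_rle0 ?invr_gt0// subr_le0 ltW.
have uv' (t : R) : 1 <= t <= N -> u' t = v' t by rewrite /u' => /andP[_ ->].
have u0' (t : R) : N < t -> u' t = 0 by rewrite /u' leNgt => ->.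
have cv := primitive_on_continuous (ltW N1) Pv.
have t0 (t : R) : 1 <= t -> 0 < t by exact: lt_le_trans.
have cV : {within `[1, N], continuous (fun t : R => t^-1)}.
  apply: derivable_within_continuous => t; rewrite in_itv/= => /andP[t1 _].
  by have [] : is_derive t 1 (fun t : R => t^-1) (- t ^- 2)
    by apply: is_derive1_inv; rewrite gt_eqF// t0.
have iw : mu.-integrable `[1, N] (EFin \o (fun t => t ^- 2 * v t ^+ 2)).
  apply: (@eq_integrable_itv _ _ _ (fun t => (t^-1 * v t) * (t^-1 * v t))).
    by move=> t _; rewrite -exprVn; ring.
  by apply: continuous_itv_integrable; apply: within_continuous_mul; apply: within_continuous_mul.
have iv' : mu.-integrable `[1, N] (EFin \o (fun t => v' t ^+ 2)).
  by have [] := (L2onE _ (measurable_itv _)).1 Lv'.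
exists u, u'; split.
- exact: (compactly_supported_H1 N1 Pv Lv' vN uv u0 uv' u0').
- apply: within_continuous_mul.
    apply: derivable_within_continuous => t; rewrite in_itv/= andbT => t1.
    by have [] := dpow s t t1.
  apply: within_continuous_mul; first exact: within_continuous_cst.
  apply: within_continuous_add; apply: continuous_subspaceT => // t.
  by apply: (@continuous_comp _ _ _ w (fun x : R => `|x|)); [exact: cw|exact: norm_continuous].
- by rewrite uv ?lexx ?ltW.
exists (\int[mu]_(t in `[1, N]) (v' t ^+ 2)), (\int[mu]_(t in `[1, N]) (t ^- 2 * v t ^+ 2)); split.
- by apply: integral_half_line => // [t /uv' ->//|t /u0' ->]; rewrite expr0n.
- by apply: integral_half_line => // [t /uv ->//|t /u0 ->]; rewrite expr0n mulr0.
- have := hardy_identity s (ltW N1) Pv Lv'.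
  rewrite RintegralB//; last exact: integrable_itvZ.
  rewrite RintegralZl// => ->; rewrite vN v1 expr0n/= mulr0 mul0r addr0 expr1n mulr1 lerD2r.
  apply: le_trans HM.
  (* Since t^s annihilates v' - s v / t, only the slope of the cutoff remains: the square is t^(2 s)
     / M^2 <= C, over an interval of length M. *)
  pose C : R := N `^ (2 * s) / M ^+ 2.
  have CE : \int[mu]_(t in `[1, N]) C = N `^ (2 * s) / M.
    by rewrite Rintegral_cst_itv ?ltW// /C /N addrK; field; rewrite gt_eqF.
  rewrite -/N -CE; apply: le_Rintegral => //.
  + have L1 : L2on `[1, N] (fun t => v' t + (- s) * (t^-1 * v t)).
      apply: continuous_L2on; apply: within_continuous_add => //.
      apply: within_continuous_mul; first exact: within_continuous_cst.
      exact: within_continuous_mul.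
    have [_ ] := (L2onE _ (measurable_itv _)).1 L1.
    by apply: eq_integrable_itv => t _; rewrite mulNr.
  + by apply: continuous_itv_integrable; exact: within_continuous_cst.
  move=> t; rewrite /= in_itv/= => /andP[t1 tN]; have tp := t0 _ t1.
  have -> : v' t - s * (t^-1 * v t) = - (t `^ s / M).
    rewrite /v' /v powRB; last by apply/implyP => _; rewrite gt_eqF.
    by rewrite powRr1 ?ltW//; ring.
  rewrite sqrrN exprMn exprVn ler_wpM2r ?invr_ge0 ?sqr_ge0//.
  rewrite mulrC powRrM powR_mulrn ?powR_ge0//.
  rewrite ler_pXn2r ?nnegrE ?powR_ge0//.
  by apply: ge0_ler_powR => //; rewrite nnegrE ltW// (lt_trans _ N1).
(* On [1, 2] one has t^s >= 1, w >= 1/2 as M >= 2, and t^-2 >= 1/4; this gives 1/16 whatever the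
   size of M. *)
have N2 : 2 <= N by rewrite /N; lra.
rewrite (@Rintegral_itv_chasles _ _ 1 2 N)// ?ler1n//.
rewrite -[leLHS]addr0 lerD//; last first.
  by apply: Rintegral_ge0 => t _; apply: mulr_ge0; rewrite ?invr_ge0; exact: sqr_ge0.
have -> : 16^-1 = \int[mu]_(t in `[(1 : R), 2]) (16^-1 : R).
  by rewrite Rintegral_cst_itv ?ler1n//; field.
apply: le_Rintegral => //.
- by apply: continuous_itv_integrable; exact: within_continuous_cst.
- exact: integrable_sub_itv iw _ _.
move=> t; rewrite /= in_itv/= => /andP[t1 t2]; have tp := t0 _ t1.
have pw : 1 <= t `^ s.
  by rewrite -[leLHS](powRr0 t); exact: ler_powR.
have wt : 2^-1 <= w t.
  rewrite wE mulrC ler_pdivlMr//; rewrite /N; lra.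
have vt : 2^-1 <= v t.
  by rewrite /v -[leLHS]mul1r ler_pM.
have -> : 16^-1 = (2 ^+ 2)^-1 * (2^-1) ^+ 2 :> R by field.
apply: ler_pM; rewrite ?invr_ge0 ?sqr_ge0//.
  by rewrite lef_pV2 ?posrE ?exprn_gt0// ler_pXn2r ?nnegrE// ltW.
by rewrite ler_pXn2r ?nnegrE// (le_trans _ vt).
Qed.

End trial_functions.

(** * Joining the circle and the ray *)

Section assembly.
Context {R : realType}.
Local Notation mu := (@lebesgue_measure R).
Implicit Types (f g u : R -> R) (a b k l s : R).

(** k = sqrt l and s is the smaller root of s - s^2 = l. From l < b^2 <= 1/4 follow k < 1/2 and a
    positive discriminant, hence 2 s < 1. *)
Lemma lam_star_eq_params b l : 0 < b -> b <= 2^-1 -> lam_star_eq b l ->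
  exists k s, [/\ 0 < k /\ k * twopi < pi, k ^+ 2 = l, 0 <= s /\ 2 * s < 1,
    s - s ^+ 2 = l &
    2 * k * (cos (k * twopi) - cos (twopi * b)) / sin (k * twopi) = s].
Proof.
move=> b0 b2 [l0 lb eql].
have p0 := pi_gt0 R.
have l4 : 4 * l < 1 by nra.
have x0 : 0 <= 1 - 4 * l by lra.
move: eql; have := sqr_sqrtr (ltW l0); have := sqr_sqrtr x0.
have : 0 < Num.sqrt l by rewrite sqrtr_gt0.
have : 0 < Num.sqrt (1 - 4 * l) by rewrite sqrtr_gt0 subr_gt0.
set k := Num.sqrt l; set r := Num.sqrt (1 - 4 * l) => r0 k0 rE kE eql.
have k2 : k < 2^-1 by nra.
have kpi : k * twopi < pi by rewrite /twopi; nra.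
have kt0 : 0 < k * twopi by rewrite mulr_gt0// /twopi mulr_gt0.
have sn0 : 0 < sin (k * twopi) by rewrite sin_gt0_pi// kt0.
exists k, ((1 - r) / 2); split => //.
- have r1 : r <= 1 by nra.
  by split; lra.
- by rewrite -kE; move: rE; rewrite -kE => rE; field : rE.
rewrite eql (mulrC twopi k).
by field; rewrite ?gt_eqF.
Qed.

Lemma H1_primitive a b f g : a < b -> H1 `]a, b[ f g ->
  {within `[a, b], continuous f} -> primitive_on a b f g /\ L2on `[a, b] g.
Proof.
move=> ab [_ Lg wfg] cf; have Lg' := L2on_oo_cc Lg; split => //.
exact: (weak_deriv_primitive ab _ wfg cf (L2on_integrable Lg')).
Qed.

Lemma primitive_H1 a b f g : a < b -> primitive_on a b f g -> L2on `[a, b] g ->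
  H1 `]a, b[ f g.
Proof.
move=> ab fg Lg.
have sub : `]a, b[ `<=` `[a, b] by exact: subset_itv_oo_cc.
split.
- apply: (@L2onS _ `[a, b]%classic) => //; apply: continuous_L2on.
  exact: primitive_on_continuous (ltW ab) fg.
- exact: (@L2onS _ `[a, b]%classic).
- exact: primitive_on_weak_deriv.
Qed.

Lemma H1_zero (D : set R) : @H1 R D (fun=> 0) (fun=> 0).
Proof.
have L0 : L2on D (fun=> 0 : R).
  split; first exact: measurable_cst.
  by under eq_integral do rewrite expr0n; rewrite integral0.
split => // phi _.
by rewrite !integral0_eq ?oppe0// => t _; rewrite mul0r.
Qed.

Lemma integral_fineD (D : set (measurableTypeR R)) f g : measurable D ->
  mu.-integrable D (EFin \o f) -> mu.-integrable D (EFin \o g) ->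
  (\int[mu]_(t in D) (f t + g t)%:E)%E
  = (\int[mu]_(t in D) f t + \int[mu]_(t in D) g t)%:E.
Proof.
move=> mD fi gi; rewrite -RintegralD// /Rintegral fineK//.
by apply: integrable_fin_num => //; exact: (integrableD mD fi gi).
Qed.

End assembly.

Theorem theorem4p2 (R : realType) (a : R -> R) :
  L2on I1 a ->
  ~ (exists k : int, alpha_of a = k%:~R) ->
  (forall p1 q1 dp1 dq1 p2 q2 dp2 dq2 : R -> R,
     H1_Gamma p1 q1 dp1 dq1 p2 q2 dp2 dq2 ->
     ((lam_star (alpha_of a))%:E * weighted_L2 p1 q1 p2 q2
        <= h_form a p1 q1 dp1 dq1 dp2 dq2)%E)
  /\
  (forall l : R, lam_star (alpha_of a) < l ->
     exists p1 q1 dp1 dq1 p2 q2 dp2 dq2 : R -> R,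
       H1_Gamma p1 q1 dp1 dq1 p2 q2 dp2 dq2 /\
       (h_form a p1 q1 dp1 dq1 dp2 dq2 < l%:E * weighted_L2 p1 q1 p2 q2)%E).
Proof.
(* x and y are the squared real and imaginary parts at the junction: the circle gains s times their
   sum, which is what the two ray estimates lose. *)
have aux1 (l s A B x y Wp Wq Dp Dq : R) : l * A + s * (x + y) <= B ->
    l * Wp <= Dp + s * x -> l * Wq <= Dq + s * y ->
    l * (A + (Wp + Wq)) <= B + (Dp + Dq) by lra.
(* The junction terms cancel up to d. Raising l to l' gains at least (l' - l) / 16 = 2 d, from the
   lower bound 1/16 on Y. *)
have aux2 (l l' s A B X Y d : R) : B - l * A = s -> X - l * Y <= d - s ->
    0 <= A -> 16^-1 <= Y -> l < l' -> d = (l' - l) / 32 ->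
    B + X < l' * (A + Y).
  move=> h1 h2 A0 Y0 ll dE.
  have AY : 16^-1 <= A + Y by rewrite (le_trans Y0)// lerDr.
  have ll0 : 0 <= l' - l by rewrite subr_ge0 ltW.
  by have := ler_wpM2l ll0 AY; lra.
move=> La nal; set al := alpha_of a.
have /andP[b0 b2] := dist_int_itv nal.
have [k [s [[k0 kpi] kE [s0 s1] sE bal]]] := lam_star_eq_params b0 b2 (lam_star_spec nal).
rewrite -/al in kE sE bal *; set lam := lam_star al in kE sE *.
set mu := @lebesgue_measure R.
have L0 : 0 < twopi :> R by rewrite /twopi mulr_gt0// pi_gt0.
have La' : L2on `[0, twopi] a by exact: L2on_oo_cc.
have aE : \int[mu]_(t in `[0, twopi]) a t = twopi * al.
  rewrite /al /alpha_of mulrA mulfV ?gt_eqF// mul1r.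
  by rewrite /I1 integral_oo_fine//; exact: L2on_integrable.
(* The balance equation now contains the total flux of [a], as in the circle estimates. *)
rewrite cos_dist_int -aE in bal.
have m1 : measurable (`[0, twopi]%classic : set (measurableTypeR R)) by [].
have m2 : measurable (`]1, +oo[%classic : set (measurableTypeR R)) by [].
have iL2 (f : R -> R) : L2on `[0, twopi] f ->
    mu.-integrable `[0, twopi] (EFin \o (fun t => f t ^+ 2)).
  by move=> Lf; have [] := (L2onE f m1).1 Lf.
have ie (p q dp dq : R -> R) : {within `[0, twopi], continuous p} ->
    {within `[0, twopi], continuous q} ->
    L2on `[0, twopi] dp -> L2on `[0, twopi] dq ->
    mu.-integrable `[0, twopi]
      (EFin \o (fun t => (dq t - a t * p t) ^+ 2 + (dp t + a t * q t) ^+ 2)).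
  move=> cp cq Ldp Ldq; apply: integrable_itvD; apply: iL2.
    rewrite (_ : (fun t => _) = (fun t => dq t + (-1 * p t) * a t)); last first.
      by apply/funext => t; ring.
    apply: L2onD => //; apply: L2on_continuousM => //.
    by apply: within_continuous_mul => //; exact: within_continuous_cst.
  rewrite (_ : (fun t => _) = (fun t => dp t + q t * a t)); last first.
    by apply/funext => t; ring.
  by apply: L2onD => //; exact: L2on_continuousM.
have iw (p q : R -> R) : {within `[0, twopi], continuous p} ->
    {within `[0, twopi], continuous q} ->
    mu.-integrable `[0, twopi] (EFin \o (fun t => p t ^+ 2 + q t ^+ 2)).
  by move=> cp cq; apply: integrable_itvD; apply: iL2; exact: continuous_L2on.
split.
- move=> p1 q1 dp1 dq1 p2 q2 dp2 dq2
    [[Hp1 Hq1 Hp2 Hq2] [cp1 cq1 cp2 cq2] [p1L p12 q1L q12]].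
  have [Pp1 Ldp1] := H1_primitive L0 Hp1 cp1.
  have [Pq1 Ldq1] := H1_primitive L0 Hq1 cq1.
  have M := magnetic_energy_bound k0 L0 kpi La' Pp1 Pq1 Ldp1 Ldq1 p1L q1L.
  rewrite bal kE in M.
  have [ip2 Bp2] := hardy_bound s0 Hp2 cp2.
  have [iq2 Bq2] := hardy_bound s0 Hq2 cq2.
  rewrite sE -p12 in Bp2; rewrite sE -q12 in Bq2.
  have Ldp2 : L2on `]1, +oo[ dp2 by case: Hp2.
  have Ldq2 : L2on `]1, +oo[ dq2 by case: Hq2.
  rewrite /weighted_L2 /h_form /I1 /I2.
  rewrite !integral_oo_fine; [|exact: ie|exact: iw].
  rewrite (_ : (fun x : R => (x ^- 2 * (p2 x ^+ 2 + q2 x ^+ 2))%:E)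
    = (fun x => (x ^- 2 * p2 x ^+ 2 + x ^- 2 * q2 x ^+ 2)%:E)); last first.
    by apply/funext => t; rewrite mulrDr.
  rewrite !(@integral_fineD _ `]1, +oo[%classic)//.
  + by rewrite -!EFinD -EFinM lee_fin; exact: aux1 M Bp2 Bq2.
  + by have [] := (L2onE _ m2).1 Ldp2.
  + by have [] := (L2onE _ m2).1 Ldq2.
move=> l' ll'.
pose d := (l' - lam) / 32.
have d0 : 0 < d by rewrite divr_gt0// subr_gt0.
have [u [u' [Hu cu u1 [X [Y [XE YE XY Y0]]]]]] := hardy_trial s0 s1 d0.
have [p [q [dp [dq [[Pp Pq] [Ldp Ldq] [p0 pL] [q0 qL] En]]]]] :=
  magnetic_trial k0 L0 kpi La'.
rewrite bal kE in En; rewrite sE in XY.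
have cp := primitive_on_continuous (ltW L0) Pp.
have cq := primitive_on_continuous (ltW L0) Pq.
(* Both pieces take the real value 1 at the junction, so the imaginary part on the ray can be
   zero. *)
exists p, q, dp, dq, u, (fun=> 0), u', (fun=> 0); split.
  split; split => //.
  - exact: primitive_H1.
  - exact: primitive_H1.
  - exact: H1_zero.
  - exact: within_continuous_cst.
  - by rewrite p0 pL.
  - by rewrite p0 u1.
  - by rewrite q0 qL.
rewrite /weighted_L2 /h_form /I1 /I2.
rewrite !integral_oo_fine; [|exact: iw|exact: ie].
under eq_integral do rewrite expr0n addr0.
under [X in (_ < _ * (_ + X))%E]eq_integral do rewrite expr0n addr0.
rewrite XE YE -!EFinD -EFinM lte_fin.
apply: (aux2 _ _ _ _ _ _ _ _ En XY) => //.
by apply: Rintegral_ge0 => t _; rewrite addr_ge0// sqr_ge0.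
Qed.
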